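(* (1) For $\ell\ge 1$, the number of $B_{SO(2\ell-1)}$-orbits on $\mathcal{B}_{\mathfrak{so}(2\ell)}$ is $|SPIL(\ell)|$. (2) For $\ell\ge 0$, the number of $B_{SO(2\ell)}$-orbits on $\mathcal{B}_{\mathfrak{so}(2\ell+1)}$ is $|SPIL(\ell\cup\{0\})|$.
   Context: All groups and varieties are over $\mathbb{C}$. $SO(n)$ is the group of determinant-one linear maps of $\mathbb{C}^n$ preserving a nondegenerate symmetric bilinear form $\beta$. For $n=2\ell$ take a basis $e_1,\dots,e_\ell,e_{-\ell},\dots,e_{-1}$ with $\beta(e_j,e_k)=\delta_{j,-k}$; for $n=2\ell+1$ take a basis $e_1,\dots,e_\ell,e_0,e_{-\ell},\dots,e_{-1}$ with $\beta(e_j,e_k)=\delta_{j,-k}$. $\mathcal{B}_{\mathfrak{so}(n)}$ is the flag variety (variety of Borel subalgebras) of $\mathfrak{so}(n)$. $B_{n}\subset SO(n)$ is the upper triangular Borel subgroup with respect to the given ordered basis. The subgroup $K=SO(n-1)\subset SO(n)$ is: for $n=2\ell$, the subgroup of $SO(2\ell)$ fixing $e_\ell-e_{-\ell}$; for $n=2\ell+1$, the subgroup of $SO(2\ell+1)$ fixing $e_0$. $B_{SO(n-1)}:=K\cap B_n$, which is a Borel subgroup of $K$. Signed lists: for a finite set $A\subset\mathbb{Z}_{\ge0}$, a signed list of $A$ is a tuple $\sigma=(\lambda_1,\dots,\lambda_r)$ of elements of $\{\pm a: a\in A\}$ with $\lambda_p\ne\pm\lambda_q$ for $p\neq q$; put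 $|\sigma|=(|\lambda_1|,\dots,|\lambda_r|)$. A SPIL (signed partition into lists) of $A$ is an unordered collection $\Sigma=\{\sigma_1,\dots,\sigma_k\}$ of nonempty signed lists of $A$ such that the underlying sets of $|\sigma_1|,\dots,|\sigma_k|$ form a set partition of $A$, and such that (1) the last entry of each $\sigma_i$ is non-negative; (2) if $0$ occurs in $\sigma_i$, then $0$ is the last entry of $\sigma_i$. $SPIL(\ell)$ denotes the set of SPILs of $\{1,\dots,\ell\}$, and $SPIL(\ell\cup\{0\})$ the set of SPILs of $\{0,1,\dots,\ell\}$. *)

(* Defs.v *)
From mathcomp Require Import all_boot all_order all_algebra.
From mathcomp Require Import finmap.
From mathcomp Require Import boolp classical_sets functions cardinality reals.
From mathcomp Require Import complex.
Set Implicit Arguments.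
Unset Strict Implicit.
Unset Printing Implicit Defensive.

Import Order.TTheory GRing.Theory Num.Theory.

Local Open Scope classical_set_scope.
Local Open Scope ring_scope.

Section LieAlgebra.
Variables (F : fieldType) (n : nat).
Implicit Types (X Y g : 'M[F]_n) (U V : {vspace 'M[F]_n}).

Definition lie_bracket X Y : 'M[F]_n := X *m Y - Y *m X.

Definition lie_product U V : {vspace 'M[F]_n} :=
  <<[seq lie_bracket X Y | X <- vbasis U, Y <- vbasis V]>>%VS.

Definition lie_subalgebra U :=
  forall X Y, X \in U -> Y \in U -> lie_bracket X Y \in U.

Definition derived_series U k : {vspace 'M[F]_n} :=
  iter k (fun V => lie_product V V) U.

Definition lie_solvable U := exists k, derived_series U k = 0%VS.

(* The bases e_1, .., e_l, (e_0,) e_{-l}, .., e_{-1} are indexed by position   *)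
(* in 'I_n, from 0; exchanging e_j and e_{-j} is then rev_ord.                *)
Definition form_mx : 'M[F]_n := \matrix_(i, j) (j == rev_ord i)%:R.

Definition SO : set 'M[F]_n :=
  [set g | g^T *m form_mx *m g = form_mx /\ \det g = 1].

Definition so : set 'M[F]_n := [set X | X^T *m form_mx + form_mx *m X = 0].

Definition solvable_subalgebra_so U :=
  [/\ [set` U] `<=` so, lie_subalgebra U & lie_solvable U].

Definition borel_subalgebra_so U :=
  solvable_subalgebra_so U /\
  forall V, solvable_subalgebra_so V -> (U <= V)%VS -> V = U.

Definition flag_variety_so : set {vspace 'M[F]_n} :=
  [set U | borel_subalgebra_so U].

Definition Ad g : 'End('M[F]_n) := linfun (mulmxr (invmx g) \o mulmx g).

Definition Ad_orbit (H : set 'M[F]_n) U : set {vspace 'M[F]_n} :=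
  [set (Ad g @: U)%VS | g in H].

Definition orbits_flag_variety_so (H : set 'M[F]_n) :
    set (set {vspace 'M[F]_n}) :=
  [set Ad_orbit H U | U in flag_variety_so].

(* Matrices act on column vectors; is_trig_mx means lower triangular. *)
Definition upper_borel_SO : set 'M[F]_n := SO `&` [set g | is_trig_mx g^T].

Definition SO_fixing (v : 'cV[F]_n) : set 'M[F]_n :=
  SO `&` [set g | g *m v = v].

Definition basis_vec (k : nat) : 'cV[F]_n := \col_(i < n) (i == k :> nat)%:R.

End LieAlgebra.

Arguments SO : clear implicits.
Arguments so : clear implicits.
Arguments upper_borel_SO : clear implicits.

(* SO(2l - 1) in SO(2l): e_l and e_{-l} have positions l.-1 and l. *)
Definition SO_odd_in_even (F : fieldType) (l : nat) : set 'M[F]_(l.*2) :=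
  SO_fixing (basis_vec F l.*2 l.-1 - basis_vec F l.*2 l).
Arguments SO_odd_in_even : clear implicits.

(* SO(2l) in SO(2l + 1): e_0 has position l. *)
Definition SO_even_in_odd (F : fieldType) (l : nat) : set 'M[F]_(l.*2.+1) :=
  SO_fixing (basis_vec F l.*2.+1 l).
Arguments SO_even_in_odd : clear implicits.

Definition borel_SO_odd (F : fieldType) (l : nat) : set 'M[F]_(l.*2) :=
  SO_odd_in_even F l `&` upper_borel_SO F l.*2.
Arguments borel_SO_odd : clear implicits.

Definition borel_SO_even (F : fieldType) (l : nat) : set 'M[F]_(l.*2.+1) :=
  SO_even_in_odd F l `&` upper_borel_SO F l.*2.+1.
Arguments borel_SO_even : clear implicits.

Section SPIL.
Variable A : {fset nat}.

Definition abs_list (s : seq int) : seq nat := [seq `|x|%N | x <- s].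

Definition signed_list (s : seq int) : bool :=
  all (fun x : int => `|x|%N \in A) s && uniq (abs_list s).

(* The default value of last is irrelevant: partition makes s nonempty. *)
Definition SPIL : set {fset seq int} :=
  [set S : {fset seq int} |
    [/\ forall s, s \in S -> signed_list s,
        partition [set` S] (fun s => [set` abs_list s]) [set` A],
        forall s, s \in S -> 0 <= last 0 s
      & forall s, s \in S -> 0 \in s -> last 0 s = 0]].

End SPIL.

(* Main.v *)
(* Lie's theorem, applied first to C^n and then to the orthogonal of a
   non-isotropic eigenvector, gives every solvable subalgebra of so(n), n >= 2,
   a stable isotropic line; by induction on n and reflections it is conjugate
   under O(n) to an upper triangular one, so that the Borel subalgebras are the
   conjugates Ad(g) b of the upper triangular subalgebra b, with g in O(n).

   Let v be the vector fixed by K. By the Bruhat decomposition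
   an orbit of B_K amounts to an order p on the basis (compatible with the
   duality e_i <-> e_(-i), up to the exchange of e_l and e_(-l) for n = 2l)
   and an orbit of the matrices of B which are also triangular for p
   on the vectors b^-1 v, b in B. Root subgroups delete a coordinate i
   as soon as another nonzero coordinate comes after i both in the standard
   order and in p; the remaining coordinates, scaled to 1 by the torus, form v
   plus the sum of the e_i over a set S no element of which precedes, in both
   orders, another element of S or a central position. Such pairs (p, S)
   classify the orbits.

   Reading the first half of the flag and cutting it after each e_(-i), i in S,
   gives lists with increasing last entries followed by a list containing the
   central letter; flipping the sign of the letters -i, this is a signed
   partition into lists written in a canonical order. *)

Require Import Defs.
From HB Require Import structures.
From mathcomp Require Import all_boot all_order all_algebra.
From mathcomp Require Import finmap.
From mathcomp Require Import boolp classical_sets functions cardinality reals.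
From mathcomp Require Import complex.
From mathcomp Require Import perm zify ring.
Set Implicit Arguments.
Unset Strict Implicit.
Unset Printing Implicit Defensive.

Import Order.TTheory GRing.Theory Num.Theory.

Local Open Scope ring_scope.

(** * Triangularity with respect to a pair of orders *)

(** Reflections have determinant -1, so conjugation is natural in O(n) only. This costs nothing at
    the end: an upper triangular orthogonal matrix fixing v has determinant 1, so the group whose
    orbits are counted is the full stabilizer of v among the triangular matrices of O(n). That
    distinct pairs (p, S) give distinct orbits is proved by conjugating elements of the Borel
    subalgebra attached to p: root vectors recover the order p, and elements of the torus recover S.
    The order of a dual pair e_i, e_(-i) escapes this test, because skew matrices vanish at dual
    positions. All such comparisons follow from others, except that of the two central vectors in
    even dimension, and this is where the exchange comes from. No bijection is written down. The
    orbits and the signed partitions are both images of the finite set of pairs (p, S), under two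
    maps with the same fibres: equal S, and p up to the exchange. *)

Section Ranks.
Variables (F : fieldType) (n : nat).
Implicit Types (A B : 'M[F]_n) (p q r : 'S_n).

(* p ranks the rows and q the columns; for p = q = 1 this is upper triangularity. *)
Definition uptri p q A := forall i j, (q j < p i)%N -> A i j = 0.

Lemma uptri_mul p q r A B : uptri p q A -> uptri q r B -> uptri p r (A *m B).
Proof.
move=> hA hB i j hij; rewrite mxE big1 // => k _.
case: (ltnP (q k) (p i)) => [/hA -> | hk]; first by rewrite mul0r.
by rewrite (hB k j) ?mulr0 //; apply: leq_trans hij hk.
Qed.

Lemma uptri1 p : uptri p p 1%:M.
Proof. by move=> i j; rewrite mxE; case: eqP => [->|//]; rewrite ltnn. Qed.

Lemma uptriD p q A B : uptri p q A -> uptri p q B -> uptri p q (A + B).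
Proof. by move=> hA hB i j hij; rewrite mxE hA // hB // addr0. Qed.

Lemma uptriZ p q a A : uptri p q A -> uptri p q (a *: A).
Proof. by move=> hA i j hij; rewrite mxE hA // mulr0. Qed.

Lemma uptriN p q A : uptri p q A -> uptri p q (- A).
Proof. by move=> hA i j hij; rewrite mxE hA // oppr0. Qed.

Lemma unitmx_nz_perm A : A \in unitmx -> exists s : 'S_n, forall i, A i (s i) != 0.
Proof.
rewrite unitmxE unitfE => dA.
case: (pickP (fun s : 'S_n => [forall i, A i (s i) != 0])) => [s /forallP|no].
  by exists s.
case/eqP: dA; rewrite /determinant big1 // => s _.
have /forallPn[i /negPn/eqP Ai0] := negbT (no s).
by rewrite (bigD1 i) //= Ai0 mul0r mulr0.
Qed.

(** The values of two permutations have the same sum, so no inequality can be strict. *)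
Lemma leq_perm p q : (forall i, p i <= q i)%N -> p = q.
Proof.
move=> hpq; apply/permP => i; apply/val_inj/eqP => /=.
have /leqif_sum := fun (i : 'I_n) (_ : true) => leqif_eq (hpq i).
have sumE (r : 'S_n) : (\sum_i r i = \sum_(i < n) i)%N.
  by rewrite [RHS](reindex_inj (@perm_inj _ r)).
by case=> _; rewrite !sumE eqxx => /esym/forallP/(_ i).
Qed.

(** A nonzero term of the determinant, at a permutation [s], forces p <= s * q pointwise by
    triangularity. Hence p = s * q, and the nonzero entries selected by [s] are those where the two
    ranks agree. *)
Lemma uptri_diag p q A : A \in unitmx -> uptri p q A ->
  forall i j, p i = q j -> A i j != 0.
Proof.
move=> /unitmx_nz_perm[s hs] hA i j pq.
have ps : p = (s * q)%g.
  apply: leq_perm => k; rewrite permM leqNgt; apply/negP => /hA/eqP.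
  by rewrite (negPf (hs k)).
by move: pq; rewrite ps permM => /perm_inj <-.
Qed.

Lemma uptri_invmx p q A : A \in unitmx -> uptri p q A -> uptri q p (invmx A).
Proof.
move=> uA hA i j; have [m] := ubnP (n - q i)%N.
elim: m i => // m IH i hm hij.
(* Back substitution from the highest rank down: in row [i0] of A *m invmx A = 1, the terms of rank
   below [q i] vanish by triangularity and those above by induction, so the pivot term vanishes
   too. *)
pose i0 := (p^-1)%g (q i).
have pi0 : p i0 = q i by rewrite permKV.
have := congr1 (fun M : 'M_n => M i0 j) (mulmxV uA).
rewrite !mxE (bigD1 i) //= big1 ?addr0 => [|k ki].
  case: eqP => [e|_ /eqP]; first by move: hij; rewrite -pi0 e ltnn.
  by rewrite mulf_eq0 (negPf (uptri_diag uA hA pi0)) => /eqP.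
case: (ltnP (q k) (p i0)) => [/hA -> | ]; first by rewrite mul0r.
rewrite pi0 leq_eqVlt => /orP[/eqP/val_inj/perm_inj e|lt].
  by rewrite e eqxx in ki.
by rewrite (IH k) ?mulr0 ?(leq_ltn_trans (ltnW hij)) ?(ltn_trans hij) //;
  have := ltn_ord (q k); have := ltn_ord (q i); lia.
Qed.

End Ranks.

(** * The Bruhat decomposition *)

Section Bruhat.
Variables (F : fieldType) (n : nat).
Implicit Types (A B g u : 'M[F]_n) (p : 'S_n).

Definition revp : 'S_n := perm (@rev_ord_inj n).

(* The pivot of a column is its lowest nonzero entry outside the rows that
   already carry a pivot; f j is the index of the column whose pivot lies in
   row j, and k if row j carries no pivot after k steps. *)
Lemma bruhat_step g k : g \in unitmx -> (k <= n)%N ->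
  exists (f : 'I_n -> nat) u,
    [/\ [/\ forall j, (f j <= k)%N,
        forall i j, (f i < k)%N -> f i = f j -> i = j &
        #|[pred j | (f j < k)%N]| = k],
      forall i, u i i = 1,
      forall i j : 'I_n, (j < i)%N -> u i j = 0,
      forall i j, (f i <= f j)%N -> i != j -> u i j = 0
    & forall i j : 'I_n, (i < k)%N -> (i < f j)%N -> (u *m g) j i = 0].
Proof.
move=> ug; elim: k => [|k IH] lekn.
  exists (fun _ => 0%N), 1%:M; split => //.
  - split=> //.
    by apply: eq_card0 => j; rewrite inE.
  - by move=> i; rewrite mxE eqxx.
  - by move=> i j ij; rewrite mxE; case: eqP => // e; rewrite e ltnn in ij.
  - by move=> i j _ ij; rewrite mxE (negPf ij).
case: (IH (ltnW lekn)) => f [u [[f1 f2 f3] u1 u2 u3 h0]].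
set h := u *m g in h0.
pose K : 'I_n := Ordinal lekn.
have uh : h \in unitmx.
  rewrite unitmx_mul ug andbT unitmxE.
  suff -> : \det u = 1 by rewrite unitr1.
  rewrite -det_tr det_trig; first by rewrite big1 // => i _; rewrite mxE.
  by apply/is_trig_mxP => i j ij; rewrite mxE u2.
(* Otherwise the k+1 rows in which a nonzero term of the determinant meets the columns 0, .., k
   would all be among the k rows that carry a pivot. *)
have [j0 fj0 hj0] : exists2 j, f j = k & h j K != 0.
  case: (pickP (fun j => (f j == k) && (h j K != 0))) => [j /andP[/eqP]|no].
    by exists j.
  have [s hs] := unitmx_nz_perm uh.
  have sub (i : 'I_n) : (i <= k)%N -> (f (s^-1 i)%g < k)%N.
    move=> ik; have := hs (s^-1 i)%g; rewrite permKV => hi.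
    move: ik; rewrite leq_eqVlt => /orP[/eqP ik|ik].
      have := no (s^-1 i)%g; have -> : K = i by apply: val_inj.
      by rewrite hi andbT ltn_neqAle f1 andbT => ->.
    rewrite (leq_ltn_trans _ ik) // leqNgt; apply: contra hi => /(h0 _ _ ik) ->.
    by [].
  have : (k.+1 <= k)%N; last by rewrite ltnn.
  rewrite -{2}f3.
  have <- : #|[set (s^-1)%g i | i in [pred i : 'I_n | (i <= k)%N]]| = k.+1.
    rewrite card_imset; last exact: perm_inj.
    rewrite -sum1_card (big_ord_narrow_cond lekn (P := predT)) /=.
    by rewrite sum1_card card_ord.
  apply/subset_leq_card/fintype.subsetP => _ /imsetP[i ik ->].
  by rewrite inE; apply: sub.
have [r /andP[/eqP fr hr] rmax] :
    {r | (f r == k) && (h r K != 0) & forall j, (f j == k) && (h j K != 0) -> (j <= r)%N}.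
  have P0 : (f j0 == k) && (h j0 K != 0) by rewrite fj0 eqxx.
  by case: (arg_maxnP (P := fun j => (f j == k) && (h j K != 0)) val P0) => r; exists r.
pose f' j := if j == r then k else if f j == k then k.+1 else f j.
(* [E] clears column k in the rows above [r] that carry no pivot. Those below [r] already have a
   zero there, as [r] is the lowest choice, so [E] is upper unitriangular. *)
pose c (i : 'I_n) := if [&& (i < r)%N & f i == k] then h i K / h r K else 0.
pose E : 'M[F]_n := \matrix_(i, j) ((i == j)%:R - (j == r)%:R * c i).
have EM B i m : (E *m B) i m = B i m - c i * B r m.
  rewrite mxE (eq_bigr (fun j => (i == j)%:R * B j m - (j == r)%:R * (c i * B j m))).
    rewrite sumrB (bigD1 i) //= eqxx mul1r big1 ?addr0 => [|j ji]; last first.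
      by rewrite eq_sym (negPf ji) mul0r.
    rewrite (bigD1 r) //= eqxx mul1r big1 ?addr0 // => j jr.
    by rewrite (negPf jr) mul0r.
  by move=> j _; rewrite mxE mulrBl mulrA.
have f'k j : (f' j < k.+1)%N = (j == r) || (f j < k)%N.
  rewrite /f'; case: eqP => [_|_] /=; first by rewrite ltnS leqnn.
  case: eqP => [->|/eqP ne]; first by rewrite !ltnn.
  by rewrite ltnS leq_eqVlt (negPf ne).
have f'f i j : (f' i <= f' j)%N -> (f i <= f j)%N.
  rewrite /f'; have := f1 i; have := f1 j.
  case: (i =P r) => [ir|_]; case: (j =P r) => [jr|_];
  by case: (f i =P k) => ?; case: (f j =P k) => ?; rewrite ?ir ?jr ?fr; lia.
exists f', (E *m u); split.
- split.
  + by move=> j; rewrite /f'; case: ifP => // _; case: ifP => // _; rewrite (leq_trans (f1 j)).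
  + move=> i j; rewrite f'k => /orP[/eqP->|fi]; rewrite /f'.
      rewrite eqxx; case: eqP => [-> //|_].
      by case: eqP => [_|ne e]; [lia|rewrite -e in ne].
    case: (i =P r) => [ir|_]; first by rewrite ir fr ltnn in fi.
    rewrite (ltn_eqF fi); case: eqP => [_ e|_]; first by rewrite e ltnn in fi.
    case: eqP => [_ e|_]; [lia|exact: f2].
  + rewrite (eq_card (B := [predU1 r & [pred j | (f j < k)%N]])).
      by rewrite cardU1 inE fr ltnn f3.
    by move=> j; rewrite !inE f'k.
- move=> i; rewrite EM u1 /c; case: ifP => [/andP[ir _]|_]; rewrite ?mul0r ?subr0 //.
  by rewrite u2 // mulr0 subr0.
- move=> i j ji; rewrite EM u2 // /c; case: ifP => [/andP[ir _]|_]; rewrite ?mul0r ?subr0 //.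
  by rewrite (u2 r) ?mulr0 ?subr0 //; apply: ltn_trans ir.
- move=> i j fij nij; rewrite EM u3 ?f'f // /c.
  case: ifP => [/andP[ir /eqP fi]|_]; rewrite ?mul0r ?subr0 //.
  have jr : r != j.
    apply/eqP => e; move: fij; rewrite /f' -e eqxx fi eqxx.
    by case: eqP => [e'|_]; [rewrite e' ltnn in ir | rewrite ltnn].
  by rewrite (u3 r j) // ?mulr0 ?subr0 // fr -fi f'f.
- move=> i j; rewrite ltnS leq_eqVlt -mulmxA EM -/h => /orP[/eqP ik|ik] fj.
    have iK : i = K by apply: val_inj.
    rewrite iK; move: fj; rewrite /f' ik; case: eqP => [_|/eqP jr]; first by rewrite ltnn.
    case: eqP => [fj _|fj]; last by have := f1 j; lia.
    rewrite /c fj eqxx andbT; case: ltnP => jr'; first by rewrite divfK // subrr.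
    rewrite mul0r subr0; apply/eqP/negPn/negP => hj.
    have := rmax j; rewrite fj eqxx hj => /(_ isT) => jr2.
    by case/eqP: jr; apply: val_inj; apply/eqP; rewrite eqn_leq jr2.
  rewrite (h0 i r) ?fr // mulr0 subr0 h0 //.
  by move: fj; rewrite /f'; case: eqP => [->|_]; [rewrite fr|case: eqP => [->|]].
Qed.

(** The off-diagonal entries of [u] are confined to places whose order [p] reverses. This makes the
    factorization unique, which is what the orthogonal version rests on. *)
Lemma bruhat g : g \in unitmx -> exists p u,
  [/\ forall i, u i i = 1, uptri 1 1 u,
      forall i j, (p i <= p j)%N -> i != j -> u i j = 0 & uptri p 1 (u *m g)].
Proof.
move=> /bruhat_step/(_ (leqnn n))[f [u [[f1 f2 f3] u1 u2 u3 h0]]].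
have fn j : (f j < n)%N.
  have /subset_cardP : #|[pred j | (f j < n)%N]| = #|'I_n| by rewrite f3 card_ord.
  by move=> /(_ (subset_predT _)) /(_ j); rewrite !inE.
pose f' j := Ordinal (fn j).
have f'_inj : injective f' by move=> i j /(congr1 val) /=; apply: f2.
exists (perm f'_inj), u; split=> //.
- by move=> i j; rewrite !perm1; apply: u2.
- by move=> i j; rewrite !permE; apply: u3.
- by move=> j i; rewrite perm1 permE; apply: h0.
Qed.
End Bruhat.

(** * The orthogonal group and its Bruhat decomposition *)

Section Adjoint.
Variables (F : fieldType) (n : nat).
Implicit Types (A B g u : 'M[F]_n) (p q : 'S_n).

(* The adjoint with respect to the form pairing e_i with e_(rev i). *)
Definition adjm A : 'M[F]_n := \matrix_(i, j) A (rev_ord j) (rev_ord i).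

Lemma adjmK : involutive adjm.
Proof. by move=> A; apply/matrixP => i j; rewrite !mxE !rev_ordK. Qed.

Lemma adjm1 : adjm 1%:M = 1%:M.
Proof. by apply/matrixP => i j; rewrite !mxE (inj_eq rev_ord_inj) eq_sym. Qed.

Lemma adjmM A B : adjm (A *m B) = adjm B *m adjm A.
Proof.
apply/matrixP => i j; rewrite !mxE (reindex_inj rev_ord_inj) /=.
by apply: eq_bigr => k _; rewrite !mxE mulrC.
Qed.

Lemma adjmD A B : adjm (A + B) = adjm A + adjm B.
Proof. by apply/matrixP => i j; rewrite !mxE. Qed.

Lemma adjmN A : adjm (- A) = - adjm A.
Proof. by apply/matrixP => i j; rewrite !mxE. Qed.

Lemma adjmZ a A : adjm (a *: A) = a *: adjm A.
Proof. by apply/matrixP => i j; rewrite !mxE. Qed.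

Definition orth g := adjm g *m g = 1%:M.

Lemma orth_unit g : orth g -> g \in unitmx.
Proof. by case/mulmx1_unit. Qed.

Lemma orth_inv g : orth g -> invmx g = adjm g.
Proof.
move=> og; apply: (can_inj (mulKmx (orth_unit og))).
by rewrite mulmxV ?orth_unit // (mulmx1C og).
Qed.

Lemma orthV g : orth g -> g *m adjm g = 1%:M.
Proof. exact: mulmx1C. Qed.

Lemma orth_adj g : orth g -> orth (adjm g).
Proof. by rewrite /orth adjmK => /orthV. Qed.

Lemma orthM g u : orth g -> orth u -> orth (g *m u).
Proof. by rewrite /orth adjmM mulmxA -(mulmxA (adjm u)) => ->; rewrite mulmx1. Qed.

Lemma orth1 : orth 1%:M.
Proof. by rewrite /orth adjm1 mulmx1. Qed.

Lemma orthK g A : orth g -> adjm g *m (g *m A *m adjm g) *m g = A.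
Proof. by move=> og; rewrite !mulmxA og mul1mx -mulmxA og mulmx1. Qed.

Definition rev_conj p : 'S_n := (revp n * p * revp n)%g.

Lemma rev_conjE p i : rev_conj p i = rev_ord (p (rev_ord i)).
Proof. by rewrite !permM !permE. Qed.

(** These permutations form the hyperoctahedral group, the Weyl group of type B. In even dimension
    it belongs to O(n) and is larger than the Weyl group of SO(n). *)
Definition rev_sym p := rev_conj p = p.

Lemma rev_symE p : rev_sym p -> forall i, p (rev_ord i) = rev_ord (p i).
Proof. by move=> sp i; rewrite -{2}sp rev_conjE rev_ordK. Qed.

Lemma rev_sym1 : rev_sym 1.
Proof. by apply/permP => i; rewrite rev_conjE !perm1 rev_ordK. Qed.

Lemma uptri_adj_conj p q A : uptri p q A -> uptri (rev_conj q) (rev_conj p) (adjm A).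
Proof.
move=> hA i j; rewrite !rev_conjE /= mxE => lt; apply: hA; move: lt.
have := ltn_ord (q (rev_ord i)); have := ltn_ord (p (rev_ord j)); lia.
Qed.

Lemma uptri_adj p q A : rev_sym p -> rev_sym q -> uptri p q A -> uptri q p (adjm A).
Proof. by move=> sp sq /uptri_adj_conj; rewrite sp sq. Qed.

(* Applying adjm to the refined Bruhat decomposition of g^-1 = adjm g gives
   another decomposition of g; it is unique, so its factors are orthogonal. *)
Lemma orth_bruhat g : orth g -> exists p u,
  [/\ rev_sym p, orth u, uptri 1 1 u & uptri p 1 (u *m g)].
Proof.
move=> og; have ug := orth_unit og.
have [p [u [u1 uu up' uh]]] := bruhat ug.
set h := u *m g in uh.
have Uu : u \in unitmx.
  rewrite unitmxE; suff -> : \det u = 1 by rewrite unitr1.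
  rewrite -det_tr det_trig; first by rewrite big1 // => i _; rewrite mxE.
  by apply/is_trig_mxP => i j ij; rewrite mxE uu // !perm1.
have Uh : h \in unitmx by rewrite unitmx_mul Uu.
pose u2 := adjm (invmx u); pose h2 := adjm (invmx h).
have g2 : u2 *m g = h2.
  rewrite /h2 (_ : invmx h = adjm g *m invmx u) ?adjmM ?adjmK //.
  apply: (can_inj (mulKmx Uh)); rewrite mulmxV //.
  by rewrite /h mulmxA -(mulmxA u) (orthV og) mulmx1 mulmxV.
pose c := u2 *m invmx u.
have hc : c *m h = h2 by rewrite /c /h mulmxA mulmxKV.
have cE : c = h2 *m invmx h by rewrite -hc mulmxK.
(* [r] is the order opposite to [p], and [u] is triangular for it. The quotient [c] of the two
   factorizations is thus triangular for [r] and, once [p] is known to be symmetric, for [p]; so it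
   is diagonal, with ones on the diagonal. *)
pose r := (p * revp n)%g.
have rE i j : (r i < r j)%N = (p j < p i)%N.
  by rewrite !permM !permE /=; have := ltn_ord (p i); have := ltn_ord (p j); lia.
have ur : uptri r r u.
  move=> i j; rewrite rE => ij; apply: up'; first exact: ltnW.
  by apply/eqP => e; rewrite e ltnn in ij.
have u11 : uptri 1 1 (invmx u) by apply: uptri_invmx.
have urr : uptri r r (invmx u) by apply: uptri_invmx.
have uV1 i : invmx u i i = 1.
  have := congr1 (fun M : 'M_n => M i i) (mulmxV Uu).
  rewrite !mxE eqxx (bigD1 i) //= u1 mul1r big1 ?addr0 // => k ki.
  have [lt|ge] := ltnP k i; first by rewrite uu ?mul0r // !perm1.
  rewrite u11 ?mulr0 // !perm1 ltn_neqAle ge andbT eq_sym; exact: ki.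
have u2d i : u2 i i = 1 by rewrite mxE uV1.
have u211 : uptri 1 1 u2 by rewrite -rev_sym1; apply: uptri_adj_conj.
have c11 : uptri 1 1 c by apply: uptri_mul u211 u11.
have cd i : c i i = 1.
  rewrite mxE (bigD1 i) //= u2d uV1 mul1r big1 ?addr0 // => k ki.
  have [lt|ge] := ltnP k i; first by rewrite u211 ?mul0r // !perm1.
  rewrite u11 ?mulr0 // !perm1 ltn_neqAle ge andbT eq_sym; exact: ki.
have h2p : uptri (rev_conj p) 1 h2.
  by rewrite -rev_sym1; apply: uptri_adj_conj; apply: uptri_invmx.
have cp : uptri (rev_conj p) p c by rewrite cE; apply: uptri_mul h2p _; apply: uptri_invmx.
have sp : rev_sym p.
  apply: leq_perm => i; rewrite leqNgt; apply/negP => /cp/eqP.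
  by rewrite cd oner_eq0.
have sr : rev_sym r.
  by apply/permP => i; rewrite rev_conjE !permM !permE rev_symE ?rev_ordK.
have u2r : uptri r r u2 by rewrite -sr; apply: uptri_adj_conj.
have cr : uptri r r c by apply: uptri_mul u2r urr.
have c1 : c = 1%:M.
  apply/matrixP => i j; rewrite [RHS]mxE; case: (i =P j) => [->|/eqP nij]; first by rewrite cd.
  rewrite sp in cp.
  have := cp i j; have := cr i j; rewrite rE.
  case: (ltngtP (p i) (p j)) => [_ -> //|_ _ -> //|/val_inj/perm_inj e].
  by rewrite e eqxx in nij.
have u2u : u2 = u.
  by rewrite -[RHS]mul1mx -c1 /c mulmxKV.
exists p, u; split=> //.
by rewrite /orth -{1}u2u adjmK mulVmx.
Qed.

End Adjoint.

(** * Normal forms of vectors *)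

Section Reduction.
Variables (F : numFieldType) (n : nat).
Implicit Types (A B g u : 'M[F]_n) (p q : 'S_n) (x : 'cV[F]_n) (i j k : 'I_n).
Implicit Type S : {set 'I_n}.

(** The margin of one excludes both middle positions of an even dimension, so that e_l and e_(-l)
    are central there just as e_0 is in odd dimension. *)
Definition lower i := (i.+1 < rev_ord i)%N.
Definition central i := ~~ lower i && ~~ lower (rev_ord i).

Lemma central_rev i : central (rev_ord i) = central i.
Proof. by rewrite /central rev_ordK andbC. Qed.

Lemma central_eq i j : central i -> central j -> j = i \/ j = rev_ord i.
Proof.
rewrite /central /lower /= => /andP[a b] /andP[c d].
have := ltn_ord i; have := ltn_ord j => hj hi.
have [e|e] : (j = i :> nat \/ j = n - i.+1 :> nat)%N by lia.
  by left; apply: val_inj.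
by right; apply: val_inj.
Qed.

Lemma lower_lt i : lower i -> (i < rev_ord i)%N.
Proof. by rewrite /lower; lia. Qed.

Lemma lower_rev i : lower i -> lower (rev_ord i) = false.
Proof. by rewrite /lower rev_ordK => h; apply/negbTE; lia. Qed.

Lemma lower_central i : lower i -> central i = false.
Proof. by rewrite /central => ->. Qed.

Lemma lower_central_lt i j : lower i -> central j -> (i < j)%N && (j < rev_ord i)%N.
Proof.
rewrite /central /lower /= => ? /andP[? ?]; have := ltn_ord i; have := ltn_ord j; lia.
Qed.

Lemma lower_lower_lt i j : lower i -> lower j -> (i < rev_ord j)%N.
Proof.
rewrite /lower /=; have := ltn_ord i; have := ltn_ord j; lia.
Qed.

Lemma lowerVctr i : [|| lower i, central i | lower (rev_ord i)].
Proof. by rewrite /central; case: (lower i); case: (lower (rev_ord i)). Qed.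

(* e_0 in odd dimension, e_l - e_(-l) in even dimension. *)
Definition vref : 'cV[F]_n :=
  \col_i if central i then if (i <= rev_ord i)%N then 1 else -1 else 0.

Lemma vref_neq0 i : (vref i 0 != 0) = central i.
Proof.
rewrite mxE; case: (central i); last by rewrite eqxx.
by case: ifP; rewrite ?oppr_eq0 ?oner_eq0.
Qed.

Definition dual_row x : 'rV[F]_n := \row_i x (rev_ord i) 0.

Lemma dual_rowM A x : dual_row (A *m x) = dual_row x *m adjm A.
Proof.
apply/matrixP => i j; rewrite !mxE (reindex_inj rev_ord_inj) /=.
by apply: eq_bigr => k _; rewrite !mxE mulrC.
Qed.

(** A root vector of so(n) for the diagonal torus. For k = i it lies in the torus itself, and for k
    = rev i it is zero. *)
Definition root_mx i k : 'M[F]_n := delta_mx i k - delta_mx (rev_ord k) (rev_ord i).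

Lemma adj_delta i k : adjm (delta_mx i k) = delta_mx (rev_ord k) (rev_ord i) :> 'M[F]_n.
Proof.
apply/matrixP => a b; rewrite !mxE andbC -(inj_eq rev_ord_inj) rev_ordK.
by rewrite -[in X in _ && X](inj_eq rev_ord_inj) rev_ordK.
Qed.

Lemma adj_root_mx i k : adjm (root_mx i k) = - root_mx i k.
Proof. by rewrite adjmD adjmN !adj_delta !rev_ordK opprB. Qed.

Lemma uptri_delta p i k : (p i <= p k)%N -> uptri p p (delta_mx i k : 'M[F]_n).
Proof.
move=> ik a b; rewrite mxE; case: eqP => // ->; case: eqP => // ->.
by rewrite ltnNge ik.
Qed.

Lemma uptri_root_mx p i k : rev_sym p -> (p i <= p k)%N -> uptri p p (root_mx i k).
Proof.
move=> sp ik; apply: uptriD; first exact: uptri_delta.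
apply/uptriN/uptri_delta; rewrite !rev_symE //=.
by have := ltn_ord (p i); have := ltn_ord (p k); lia.
Qed.

Section Eichler.
Variables (i k : 'I_n) (a : F).
Hypotheses (nii : i != rev_ord i) (nki : k != i) (nki' : k != rev_ord i).
Let N := root_mx i k.

(** The square of N survives only if [k] is its own dual, as the position of e_0 is; then it is a
    multiple of the matrix unit at (i, rev i). *)
Lemma root_mx_cube : N *m N *m N = 0.
Proof.
have nik' : rev_ord i != rev_ord k by rewrite (inj_eq rev_ord_inj) eq_sym.
rewrite /N /root_mx !(mulmxBl, mulmxBr) !mul_delta_mx_cond.
rewrite [rev_ord i == i]eq_sym (negPf nki) (negPf nii) (negPf nik').
rewrite !mulr0n !mul0mx !subr0 !sub0r !opprK.
case: eqP => _; rewrite ?mulr0n ?mul0mx ?oppr0 ?addr0 // !mulr1n.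
by rewrite !mul_delta_mx_0 ?oppr0 ?addr0 // eq_sym.
Qed.

(* The exponential of a *: N, as N ^ 3 = 0. *)
Definition eichler : 'M[F]_n := 1%:M + a *: N + (a ^+ 2 / 2) *: (N *m N).

Lemma adj_eichler : adjm eichler = 1%:M - a *: N + (a ^+ 2 / 2) *: (N *m N).
Proof.
by rewrite !adjmD adjm1 !adjmZ adjmM adj_root_mx scalerN mulNmx mulmxN opprK.
Qed.

Lemma eichler_orth : orth eichler.
Proof.
rewrite /orth adj_eichler /eichler; set b := a ^+ 2 / 2.
have hb : a * a = b + b by rewrite /b; field.
move: root_mx_cube; generalize N => M M3.
rewrite !(mulmxDl, mulmxDr, mul1mx, mulmx1, mulNmx, mulmxN).
rewrite -!scalemxAl -!scalemxAr !mulmxA M3 !mul0mx !scaler0 !scalerA hb.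
rewrite subr0 !addr0 scalerDl opprD !addrA addrNK.
by rewrite addrAC !addrK.
Qed.

Lemma uptri_eichler p : rev_sym p -> (p i <= p k)%N -> uptri p p eichler.
Proof.
move=> sp ik; have h := uptri_root_mx sp ik.
by apply: uptriD; [apply: uptriD; [exact: uptri1 | exact: uptriZ] | apply/uptriZ/(uptri_mul h h)].
Qed.

Lemma eichlerE x : x (rev_ord i) 0 = 0 ->
  eichler *m x = \col_r (x r 0 + (r == i)%:R * (a * x k 0)).
Proof.
move=> xi.
have NE y : N *m y = \col_r ((r == i)%:R * y k 0 - (r == rev_ord k)%:R * y (rev_ord i) 0).
  have dE s t (z : 'cV[F]_n) : delta_mx s t *m z = \col_r ((r == s)%:R * z t 0).
    apply/matrixP => r c; rewrite !mxE (bigD1 t) //= big1 ?addr0.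
      by rewrite mxE eqxx andbT (ord1 c).
    by move=> l lt; rewrite mxE (negPf lt) andbF mul0r.
  by rewrite mulmxBl !dE; apply/matrixP => r c; rewrite !mxE.
have N1 : N *m x = \col_r ((r == i)%:R * x k 0).
  by rewrite NE; apply/matrixP => r c; rewrite !mxE xi mulr0 subr0.
have N2 : N *m N *m x = 0.
  rewrite -mulmxA N1 NE; apply/matrixP => r c; rewrite !mxE (negPf nki).
  by rewrite [rev_ord i == i]eq_sym (negPf nii) !mul0r !mulr0 subr0.
rewrite /eichler 2!mulmxDl mul1mx -2!scalemxAl N1 N2 scaler0 addr0.
by apply/matrixP => r c; rewrite !mxE (ord1 c); ring.
Qed.
End Eichler.

(** Two conditions that every vector in the orbit of [vref] under the upper triangular orthogonal
    matrices satisfies. They also suffice, by [reduce] for the standard order. *)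
Definition vref_like x :=
  (forall i, lower (rev_ord i) -> x i 0 = 0) /\ dual_row x *m x = dual_row vref *m vref.

Lemma vref_like_central x c : vref_like x -> central c -> 
  x c 0 * x (rev_ord c) 0 = vref c 0 * vref (rev_ord c) 0.
Proof.
move=> [x0 xq] cc.
(* A lower coordinate is multiplied by its vanishing dual, so only central positions contribute to
   the quadratic form, all of them equally; their number cancels in characteristic 0. *)
have key (y : 'cV[F]_n) : (forall i, lower (rev_ord i) -> y i 0 = 0) ->
    (dual_row y *m y) 0 0 = (y c 0 * y (rev_ord c) 0) *+ #|central|.
  move=> y0; rewrite mxE (bigID central) /= [X in _ + X]big1 ?addr0 => [|i ci].
    rewrite -sumr_const; apply: eq_bigr => i ci; rewrite mxE.
    by case: (central_eq cc ci) => ->; rewrite ?rev_ordK // mulrC.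
  rewrite mxE; have := lowerVctr i; rewrite (negPf ci) /= => /orP[l|/y0->].
    by rewrite y0 ?mul0r // rev_ordK.
  by rewrite mulr0.
have /eqP := congr1 (fun M : 'M_1 => M 0 0) xq.
rewrite (key x) // (key vref); last first.
  by move=> i l; rewrite mxE /central l andbF.
by rewrite eqr_pMn2r; [move/eqP|rewrite lt0n; apply/existsP; exists c].
Qed.

Lemma vref_like_uptri b : orth b -> uptri 1 1 b -> vref_like (b *m vref).
Proof.
move=> ob ub; split; last first.
  by rewrite dual_rowM -mulmxA (mulmxA (adjm b)) ob mul1mx.
move=> i l; rewrite mxE big1 // => j _.
have [cj|/negPf cj] := boolP (central j); last by rewrite [vref _ _]mxE cj mulr0.
rewrite ub ?mul0r // !perm1.
by have /andP[_] := lower_central_lt l cj; rewrite rev_ordK.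
Qed.

Definition normal_vec S : 'cV[F]_n := \col_i if i \in S then 1 else vref i 0.

Definition admissible p S := [/\ rev_sym p, (forall i, i \in S -> lower i) &
  forall i k, i \in S -> (k \in S) || central k -> (i < k)%N -> (p k < p i)%N].

Lemma vref_like_torus x p : rev_sym p -> vref_like x ->
  (forall i k, lower i -> lower k || central k -> x i 0 != 0 -> x k 0 != 0 ->
    (i < k)%N -> (p k < p i)%N) ->
  exists c S, [/\ orth c, uptri 1 1 c, uptri p p c, admissible p S & c *m x = normal_vec S].
Proof.
move=> sp gx ax; have [x0 _] := gx.
have xc i : central i -> x i 0 != 0.
  move=> ci; have := vref_like_central gx ci; case: (x i 0 =P 0) => // -> /eqP.
  by rewrite mul0r eq_sym mulf_eq0 -[_ == 0]negbK vref_neq0 ci -[_ == 0]negbK vref_neq0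
    central_rev ci.
pose S := [set i | lower i && (x i 0 != 0)].
pose tl i : F := if x i 0 != 0 then (x i 0)^-1 else 1.
(* For the diagonal matrix to be orthogonal, factors at dual positions must be inverse to each
   other; at central positions this is [vref_like_central]. *)
pose t : 'rV[F]_n := \row_i if central i then vref i 0 / x i 0 else
  if lower i then tl i else (tl (rev_ord i))^-1.
have tln i : tl i != 0 by rewrite /tl; case: ifP => h; rewrite ?invr_eq0 ?oner_eq0.
have tE i : t 0 i = if central i then vref i 0 / x i 0 else
  if lower i then tl i else (tl (rev_ord i))^-1 by rewrite mxE.
have dE i j : diag_mx t i j = t 0 i *+ (i == j) by rewrite mxE.
exists (diag_mx t), S; split.
- apply/matrixP => i j; rewrite [LHS]mxE [RHS]mxE (bigD1 i) //= big1 ?addr0; last first.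
    by move=> k ki; rewrite [adjm _ _ _]mxE dE (inj_eq rev_ord_inj) (negPf ki) mul0r.
  rewrite [adjm _ _ _]mxE !dE eqxx mulr1n !tE.
  case: (i =P j) => [_|_]; last by rewrite mulr0.
  rewrite mulr1n central_rev; case: ifP => [ci|nci].
    rewrite mulrACA -invfM [x _ _ * _]mulrC (vref_like_central gx ci).
    rewrite [vref (rev_ord i) _ * _]mulrC divff //.
    by rewrite mulf_neq0 ?vref_neq0 ?central_rev.
  have := lowerVctr i; rewrite nci /= rev_ordK => /orP[l|l].
    by rewrite l lower_rev // mulVf.
  by rewrite l -[in lower i](rev_ordK i) lower_rev // mulfV.
- by move=> i j ij; rewrite dE; case: eqP => // e; rewrite e ltnn in ij.
- by move=> i j ij; rewrite dE; case: eqP => // e; rewrite e ltnn in ij.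
- split=> // [i|i k]; first by rewrite inE => /andP[].
  rewrite !inE => /andP[li xi] hk; apply: ax => //.
    by case/orP: hk => [/andP[->]|->]; rewrite ?orbT.
  by case/orP: hk => [/andP[]|/xc].
- apply/matrixP => i j; rewrite mul_diag_mx [LHS]mxE [RHS]mxE (ord1 j) inE tE.
  case: ifP => [ci|nci].
    by rewrite divfK ?xc //; case: ifP => // /andP[/lower_central]; rewrite ci.
  case: ifP => [l|nl] /=.
    rewrite /tl; case: ifP => [h|/negbFE/eqP->]; first by rewrite mulVf.
    by rewrite mulr0 [RHS]mxE nci.
  rewrite x0 ?mulr0; first by rewrite [RHS]mxE nci.
  by have := lowerVctr i; rewrite nl nci.
Qed.

Lemma reduce x p : rev_sym p -> vref_like x ->
  exists c S, [/\ orth c, uptri 1 1 c, uptri p p c, admissible p S & c *m x = normal_vec S].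
Proof.
move=> sp; have [m] := ubnP #|[pred i | x i 0 != 0]|.
elim: m x => // m IH x hm gx.
case: (pickP (fun ik : 'I_n * 'I_n => [&& lower ik.1, lower ik.2 || central ik.2,
   x ik.1 0 != 0, x ik.2 0 != 0, (ik.1 < ik.2)%N & (p ik.1 < p ik.2)%N])) => [[i k]|no]; last first.
  apply: vref_like_torus => // i k li lk xi xk ik; rewrite ltnNge leq_eqVlt.
  apply/negP => /orP[/eqP/val_inj/perm_inj e|pp]; first by rewrite e ltnn in ik.
  by have := no (i, k); rewrite /= li lk xi xk ik pp.
move=> /= /and5P[li lk xi xk /andP[ik pik]].
have nii : i != rev_ord i by rewrite neq_ltn lower_lt.
have nki : k != i by rewrite neq_ltn ik orbT.
have nki' : k != rev_ord i.
  case/orP: lk => [lk|ck]; last by have /andP[_ h] := lower_central_lt li ck; rewrite neq_ltn h.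
  by apply/eqP => e; rewrite e lower_rev in lk.
have [x0 xq] := gx.
(* This value cancels coordinate i. No other coordinate moves, because the one at [rev_ord i] is
   zero. *)
pose a := - x i 0 / x k 0; pose e := eichler i k a.
have oe : orth e by apply: eichler_orth.
have ue : uptri 1 1 e.
  by apply: uptri_eichler; rewrite ?rev_sym1 // /rev_sym ?rev_sym1 // !perm1 ltnW.
have upe : uptri p p e by apply: uptri_eichler => //; apply: ltnW.
have xE : e *m x = \col_r (if r == i then 0 else x r 0).
  rewrite eichlerE //; last by rewrite x0 // rev_ordK.
  apply/matrixP => r c; rewrite !mxE; case: eqP => [->|_].
    by rewrite mul1r /a divfK // subrr.
  by rewrite mul0r addr0.
have [||c [S [oc uc upc aS cE]]] := IH (e *m x).
- rewrite -ltnS; apply: leq_trans hm; apply: proper_card.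
  apply/properP; split.
    by apply/fintype.subsetP => r; rewrite !inE xE mxE; case: ifP; rewrite ?eqxx.
  by exists i; rewrite !inE // xE mxE eqxx eqxx.
- split; last by rewrite dual_rowM -mulmxA (mulmxA (adjm e)) oe mul1mx.
  by move=> r /x0; rewrite xE mxE; case: ifP.
exists (c *m e), S; split=> //; [exact: orthM|exact: uptri_mul uc ue|exact: uptri_mul upc upe|].
by rewrite -mulmxA.
Qed.
End Reduction.

(** * Borel subalgebras containing the diagonal torus *)

Section BorelSpaces.
Variables (F : numFieldType) (n : nat).
Implicit Types (A B X g u : 'M[F]_n) (p q : 'S_n) (i j k : 'I_n).
Implicit Types (S : {set 'I_n}) (U : {vspace 'M[F]_n}).

Definition symm_part X : 'M[F]_n := X + adjm X.
Lemma symm_part_linear : linear symm_part.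
Proof.
by move=> a X Y; rewrite /symm_part adjmD adjmZ scalerDr addrACA.
Qed.
HB.instance Definition _ :=
  GRing.isLinear.Build F 'M[F]_n 'M[F]_n *:%R symm_part symm_part_linear.

Definition lower_part p X : 'M[F]_n := \matrix_(i, j) if (p j < p i)%N then X i j else 0.
Lemma lower_part_linear p : linear (lower_part p).
Proof.
move=> a X Y; apply/matrixP => i j; rewrite !mxE.
by case: ifP; rewrite ?mulr0 ?addr0.
Qed.
HB.instance Definition _ p :=
  GRing.isLinear.Build F 'M[F]_n 'M[F]_n *:%R (lower_part p) (lower_part_linear p).

Definition borel_of p : {vspace 'M[F]_n} :=
  (lker (linfun symm_part) :&: lker (linfun (lower_part p)))%VS.

Lemma mem_borel_of p X : reflect (adjm X = - X /\ uptri p p X) (X \in borel_of p).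
Proof.
rewrite memv_cap !memv_ker !lfunE /=.
apply: (iffP andP) => [[/eqP s /eqP l]|[s l]]; split.
- by apply/eqP; rewrite -addr_eq0 addrC -s.
- move=> i j ij; have := congr1 (fun M : 'M_n => M i j) l.
  by rewrite !mxE ij.
- by rewrite /symm_part s subrr.
- apply/eqP/matrixP => i j; rewrite !mxE; case: ifP => // ij; exact: l.
Qed.

Lemma soP X : so F n X <-> adjm X = - X.
Proof.
have E i j : (X^T *m form_mx F n + form_mx F n *m X) i j = adjm X (rev_ord i) j + X (rev_ord i) j.
  rewrite !mxE (bigD1 (rev_ord j)) //= big1 ?addr0 => [|k kj]; last first.
    rewrite !mxE; case: eqP => [e|]; last by rewrite mulr0.
    by rewrite e rev_ordK eqxx in kj.
  rewrite (bigD1 (rev_ord i)) //= big1 ?addr0 => [|k kj]; last first.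
    by rewrite !mxE (negPf kj) mul0r.
  by rewrite !mxE !rev_ordK !eqxx mulr1 mul1r.
split=> h.
  apply/matrixP => i j; have := congr1 (fun M : 'M_n => M (rev_ord i) j) h.
  by rewrite /= E rev_ordK [RHS]mxE => /eqP; rewrite addr_eq0 => /eqP ->; rewrite [RHS]mxE.
rewrite /so /=; apply/matrixP => i j; rewrite E h.
by rewrite !mxE addNr.
Qed.

Lemma orthP g : g^T *m form_mx F n *m g = form_mx F n <-> orth g.
Proof.
have JJ : form_mx F n *m form_mx F n = 1%:M.
  apply/matrixP => i j; rewrite !mxE (bigD1 (rev_ord i)) //= big1 ?addr0 => [|k kj].
    by rewrite !mxE rev_ordK !eqxx mul1r eq_sym.
  by rewrite !mxE (negPf kj) mul0r.
have JE A i j : (form_mx F n *m A) i j = A (rev_ord i) j.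
  rewrite !mxE (bigD1 (rev_ord i)) //= big1 ?addr0 => [|k kj].
    by rewrite !mxE eqxx mul1r.
  by rewrite !mxE (negPf kj) mul0r.
have aE : form_mx F n *m (g^T *m form_mx F n) = adjm g.
  apply/matrixP => i j; rewrite JE !mxE (bigD1 (rev_ord j)) //= big1 ?addr0 => [|k kj].
    by rewrite !mxE rev_ordK eqxx mulr1.
  rewrite !mxE; case: eqP => [e|]; last by rewrite mulr0.
  by rewrite e rev_ordK eqxx in kj.
split=> h; first by rewrite /orth -aE -mulmxA h.
by rewrite -[LHS]mul1mx -JJ -[LHS]mulmxA [X in _ *m X]mulmxA aE h mulmx1.
Qed.

Lemma AdE g X : Ad g X = g *m X *m invmx g.
Proof. by rewrite lfunE. Qed.

Lemma mem_Ad g U X : orth g -> (X \in (Ad g @: U)%VS) = (adjm g *m X *m g \in U).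
Proof.
move=> og; apply/memv_imgP/idP => [[Y YU ->]|h].
  by rewrite AdE orth_inv // orthK.
exists (adjm g *m X *m g) => //.
by rewrite AdE orth_inv // -{1 3}[g]adjmK orthK //; apply: orth_adj.
Qed.

Lemma AdM g h U : orth g -> orth h -> (Ad (g *m h) @: U = Ad g @: (Ad h @: U))%VS.
Proof.
move=> og oh; apply/vspaceP => X; rewrite !mem_Ad //; last exact: orthM.
by rewrite adjmM !mulmxA.
Qed.

Lemma Ad1 U : (Ad 1%:M @: U = U)%VS.
Proof.
apply/vspaceP => X; rewrite mem_Ad; last exact: orth1.
by rewrite adjm1 mulmx1 mul1mx.
Qed.

Lemma AdK g U : orth g -> (Ad (adjm g) @: (Ad g @: U) = U)%VS.
Proof.
move=> og; rewrite -AdM //; last exact: orth_adj.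
by rewrite og Ad1.
Qed.

Lemma adjm_conj g X : adjm (g *m X *m adjm g) = g *m adjm X *m adjm g.
Proof. by rewrite !adjmM adjmK mulmxA. Qed.

Lemma Ad_borel_of p q g : rev_sym p -> rev_sym q -> orth g -> uptri p q g ->
  (Ad g @: borel_of q = borel_of p)%VS.
Proof.
move=> sp sq og ug; have uga := uptri_adj sp sq ug.
apply/vspaceP => X; rewrite mem_Ad //; apply/mem_borel_of/mem_borel_of => -[aX uX]; last first.
  split; last by apply: uptri_mul ug; apply: uptri_mul uX.
  by rewrite -[in X in adjm (_ *m X)](adjmK g) adjm_conj aX mulmxN mulNmx adjmK.
have -> : X = g *m (adjm g *m X *m g) *m adjm g.
  by rewrite -{1 3}[g]adjmK orthK //; apply: orth_adj.
split; last by apply: uptri_mul uga; apply: uptri_mul uX.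
by rewrite adjm_conj aX mulmxN mulNmx.
Qed.

Lemma borel_of_conj p : rev_sym p ->
  exists2 g : 'M[F]_n, orth g & (Ad g @: borel_of 1 = borel_of p)%VS.
Proof.
move=> sp; pose g : 'M[F]_n := \matrix_(i, j) (p i == j)%:R.
have og : orth g.
  apply/matrixP => i j; rewrite mxE (bigD1 (p^-1 i)%g) //= big1 ?addr0 => [|k kj].
    rewrite !mxE rev_symE // (inj_eq rev_ord_inj) permKV eqxx mul1r //.
  rewrite !mxE rev_symE // (inj_eq rev_ord_inj); case: eqP => [e|_]; last by rewrite mul0r.
  by rewrite -e permK eqxx in kj.
exists g => //; apply: Ad_borel_of => //; first exact: rev_sym1.
move=> i j; rewrite perm1 mxE; case: eqP => // ->; by rewrite ltnn.
Qed.

Lemma mul_delta_mulE A B i j a b : (A *m delta_mx i j *m B) a b = A a i * B j b.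
Proof.
rewrite mxE (bigD1 j) //= big1 ?addr0 => [|k kj].
  rewrite mxE (bigD1 i) //= big1 ?addr0 => [|k ki]; first by rewrite mxE !eqxx mulr1.
  by rewrite mxE (negPf ki) mulr0.
rewrite mxE big1 ?mul0r // => l _; by rewrite mxE (negPf kj) andbF mulr0.
Qed.

Lemma mul_root_mx_mulE A B i j a b :
  (A *m root_mx F i j *m B) a b = A a i * B j b - A a (rev_ord j) * B (rev_ord i) b.
Proof. by rewrite mulmxBr mulmxBl [LHS]mxE [X in _ + X]mxE !mul_delta_mulE. Qed.

Lemma root_mx_borel_of p i j : rev_sym p -> (p i <= p j)%N -> root_mx F i j \in borel_of p.
Proof. by move=> sp ij; apply/mem_borel_of; split; [exact: adj_root_mx | exact: uptri_root_mx]. Qed.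

End BorelSpaces.

(** * Orbits and admissible_pairs pairs *)

Section CentralSwap.
Variable n : nat.
Implicit Types (p q t : 'S_n) (i j : 'I_n) (S : {set 'I_n}).

(** In odd dimension this is the identity, the central position being its own dual; so both parities
    are treated at once. *)
Definition swapf i := if central i then rev_ord i else i.
Lemma swapf_inj : injective swapf.
Proof.
apply: (can_inj (g := swapf)) => i; rewrite /swapf.
by case ci: (central i); rewrite ?central_rev ci ?rev_ordK.
Qed.
Definition swap : 'S_n := perm swapf_inj.

Lemma swapE i : swap i = if central i then rev_ord i else i.
Proof. by rewrite permE. Qed.

Lemma swapK : (swap * swap)%g = 1%g.
Proof.
apply/permP => i; rewrite permM !swapE perm1.
by case ci: (central i); rewrite ?central_rev ci ?rev_ordK.
Qed.

Lemma swapV : (swap^-1)%g = swap.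
Proof. by apply: (mulgI swap); rewrite mulgV swapK. Qed.

Lemma swap_lt i j : j != rev_ord i -> (swap i < swap j)%N = (i < j)%N.
Proof.
move=> ji; rewrite !swapE.
case ci: (central i); case cj: (central j) => //.
- by case: (central_eq ci cj) => e; rewrite e ?eqxx // ?ltnn in ji *.
- move: ci cj ji; rewrite /central /lower /= => ci cj ji.
  have := ltn_ord i; have := ltn_ord j; move: ci cj; lia.
- move: ci cj ji; rewrite /central /lower /= => ci cj ji.
  have := ltn_ord i; have := ltn_ord j; move: ci cj; lia.
Qed.

Lemma monotone_perm1 t : (forall i j, (i < j)%N -> (t i < t j)%N) -> t = 1%g.
Proof.
move=> mt; symmetry; apply: leq_perm => i; rewrite perm1.
have [m] := ubnP (i : nat); elim: m i => // m IH i im.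
case: (posnP i) => [-> //|i0].
have li : (i.-1 < n)%N by have := ltn_ord i; lia.
have := IH (Ordinal li); have := mt (Ordinal li) i; rewrite /=; lia.
Qed.

(** A dual pair i < rev i that is not central has i+1 strictly between its members, and can be
    compared through it. Only the central pair can be inverted. *)
Lemma almost_monotone t :
  (forall i j, (i < j)%N -> j != rev_ord i -> (t i < t j)%N) -> t = 1%g \/ t = swap.
Proof.
move=> mt.
have mt2 i j : (i < j)%N -> ~~ central i || ~~ central j -> (t i < t j)%N.
  move=> ij nc; have [e|] := eqVneq j (rev_ord i); last exact: mt.
  have li : lower i.
    move: nc; rewrite e central_rev orbb /central negb_and !negbK => /orP[//|l].
    by have := lower_lt l; rewrite rev_ordK -e => /(ltn_trans ij); rewrite ltnn.
  have hk : (i.+1 < n)%N by have := ltn_ord j; move: li; rewrite /lower e /=; lia.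
  pose k := Ordinal hk.
  have ik : (t i < t k)%N.
    apply: mt; first by rewrite /=.
    by rewrite -val_eqE /= ltn_eqF.
  apply: ltn_trans ik (mt _ _ _ _); first by rewrite e.
  rewrite e (inj_eq rev_ord_inj) -val_eqE /=; by rewrite neq_ltn ltnSn.
case: (pickP (fun ij : 'I_n * 'I_n => (ij.1 < ij.2)%N && (t ij.2 <= t ij.1)%N))
    => [[c d]|no]; last first.
  left; apply: monotone_perm1 => i j ij; rewrite ltnNge.
  by have := no (i, j); rewrite /= ij /= => ->.
move=> /= /andP[cd tdc]; right.
have [cc cd'] : central c /\ central d.
  by apply/andP; rewrite -[_ && _]negbK negb_and; apply/negP => /(mt2 _ _ cd); rewrite ltnNge tdc.
have dc : d = rev_ord c.
  by case: (central_eq cc cd') => // e; rewrite e ltnn in cd.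
suff st : (swap * t)%g = 1%g.
  by rewrite -[RHS]mulg1 -st mulgA swapK mul1g.
apply: monotone_perm1 => i j ij; rewrite !permM.
have [e|ji] := eqVneq j (rev_ord i); last first.
  have := swap_lt ji; rewrite ij => /mt2 -> //.
  rewrite -negb_and; apply/negP => /andP[].
  rewrite !swapE; case ci: (central i); rewrite ?central_rev ci //.
  case cj: (central j); rewrite ?central_rev cj // => _ _.
  by case: (central_eq ci cj) => e; [rewrite e ltnn in ij | rewrite e eqxx in ji].
case ci: (central i); last by rewrite !swapE e central_rev ci -e mt2 // ci.
have ic : i = c.
  case: (central_eq cc ci) => // ei; move: ij cd; rewrite e dc ei rev_ordK => a b.
  by have := ltn_trans a b; rewrite ltnn.
rewrite e ic !swapE central_rev cc rev_ordK -dc ltn_neqAle tdc andbT.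
by apply/eqP => /val_inj/perm_inj e'; rewrite e' ltnn in cd.
Qed.

End CentralSwap.

(** * Relative position of a Borel subalgebra and the reference vector *)

Section Orbits.
Variables (F : numFieldType) (n : nat).
Implicit Types (g a b c X : 'M[F]_n) (p q : 'S_n) (i j k : 'I_n).
Implicit Types (S : {set 'I_n}) (U : {vspace 'M[F]_n}).

(** A skew matrix vanishes at dual positions, and exchanging the two central ranks changes the order
    of no other pair. *)
Lemma borel_of_swap p : rev_sym p -> borel_of F (p * swap n) = borel_of F p.
Proof.
move=> sp; apply/vspaceP => X; apply/mem_borel_of/mem_borel_of => -[aX uX]; split=> // i j ij.
- case: (i =P rev_ord j) => [e|/eqP ne].
    have := congr1 (fun M : 'M_n => M i j) aX; rewrite !mxE e rev_ordK => /eqP.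
    by rewrite -addr_eq0 -mulr2n mulrn_eq0 => /eqP.
  apply: uX; rewrite !permM swap_lt // -rev_symE // (inj_eq perm_inj).
  done.
- case: (i =P rev_ord j) => [e|/eqP ne].
    have := congr1 (fun M : 'M_n => M i j) aX; rewrite !mxE e rev_ordK => /eqP.
    by rewrite -addr_eq0 -mulr2n mulrn_eq0 => /eqP.
  by apply: uX; move: ij; rewrite !permM swap_lt // -rev_symE // (inj_eq perm_inj).
Qed.

(* The pairs (vref, U) in the same position are conjugate under the upper
   triangular orthogonal matrices, hence the U under the stabilizer of vref. *)
Definition position p S U := exists a,
  [/\ orth a, uptri 1 1 a, a *m vref F n = normal_vec F S & (Ad a @: U)%VS = borel_of F p].

Definition stab_vref b := [/\ orth b, uptri 1 1 b & b *m vref F n = vref F n].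

Lemma position_exists g : orth g ->
  exists p S, admissible p S /\ position p S (Ad g @: borel_of F 1)%VS.
Proof.
move=> og; have [p [u [sp ou uu uh]]] := orth_bruhat og.
have [c [S [oc uc upc aS cE]]] := reduce sp (vref_like_uptri ou uu).
exists p, S; split=> //; exists (c *m u); split.
- exact: orthM.
- exact: uptri_mul uc uu.
- by rewrite -mulmxA.
rewrite -AdM //; last exact: orthM.
rewrite -mulmxA AdM //; last exact: orthM.
rewrite (Ad_borel_of (p := p) (q := 1)) //; [exact: Ad_borel_of | exact: rev_sym1 | exact: orthM].
Qed.

Lemma admissible1 S : admissible 1 S -> S = finset.set0.
Proof.
case=> _ lS aS; apply/setP => i; rewrite inE; apply/negP => iS.
have li := lS _ iS.
have hk : (n./2 < n)%N by have := ltn_ord i; lia.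
pose k := Ordinal hk.
have ck : central k by rewrite /central /lower /=; lia.
have /andP[ik _] := lower_central_lt li ck.
have := aS i k iS; rewrite ck orbT ik => /(_ isT isT); rewrite !perm1.
by move=> /(ltn_trans ik); rewrite ltnn.
Qed.

Lemma vref_like_normal_vec p S : admissible p S -> vref_like (normal_vec F S).
Proof.
case=> _ lS _; have nS i : lower (rev_ord i) -> i \in S = false.
  by move=> li; apply/negP => /lS/lower_rev; rewrite li.
have v0 i : central i = false -> vref F n i 0 = 0 by move=> ci; rewrite mxE ci.
have xE i : normal_vec F S i 0 = if i \in S then 1 else vref F n i 0 by rewrite mxE.
split=> [i li|]; first by rewrite xE nS // v0 // /central li andbF.
apply/matrixP => a b; rewrite !mxE; apply: eq_bigr => i _.
rewrite ![dual_row _ _ _]mxE (ord1 b) !xE.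
case: ifP => [/lS li|_]; case: ifP => [/lS li'|_] //.
- by move: li; rewrite lower_rev.
- by rewrite [vref _ _ i _]v0 ?mulr0 // -central_rev lower_central.
- by rewrite [vref _ _ (rev_ord i) _]v0 ?mul0r // central_rev lower_central.
Qed.

(** For the standard order only the empty set is admissible, so reduction with respect to that order
    carries [normal_vec] to [vref] by an upper triangular orthogonal matrix. *)
Lemma position_nonempty p S : admissible p S ->
  exists2 g, orth g & position p S (Ad g @: borel_of F 1)%VS.
Proof.
move=> aS; have [sp _ _] := aS.
have [c [S' [oc uc _ /admissible1 S0 cE]]] := reduce (rev_sym1 n) (vref_like_normal_vec aS).
have vE : normal_vec F (finset.set0 : {set 'I_n}) = vref F n.
  by apply/matrixP => i j; rewrite !mxE !inE.
rewrite S0 vE in cE.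
have [g og gE] := borel_of_conj F sp.
exists (c *m g); first exact: orthM.
exists (adjm c); split; first exact: orth_adj.
- by apply: uptri_adj uc; apply: rev_sym1.
- by rewrite -cE mulmxA oc mul1mx.
by rewrite AdM // AdK.
Qed.

Lemma position_stab p S U b : stab_vref b -> position p S U -> position p S (Ad b @: U)%VS.
Proof.
move=> [ob ub bv] [a [oa ua av aU]]; have oab := orth_adj ob.
exists (a *m adjm b); split; first exact: orthM.
- by apply: uptri_mul ua _; apply: uptri_adj ub; apply: rev_sym1.
- by rewrite -mulmxA -[in X in _ *m X]bv (mulmxA (adjm b)) ob mul1mx.
by rewrite AdM // AdK.
Qed.

Lemma position_trans p S U U' : position p S U -> position p S U' ->
  exists2 b, stab_vref b & U' = (Ad b @: U)%VS.
Proof.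
move=> [a [oa ua av aU]] [a' [oa' ua' av' aU']]; have oad := orth_adj oa'.
exists (adjm a' *m a); last by rewrite AdM // aU -aU' AdK.
split; first exact: orthM.
- by apply: uptri_mul ua; apply: uptri_adj ua'; apply: rev_sym1.
- by rewrite -mulmxA av -av' mulmxA oa' mul1mx.
Qed.

Lemma position_swap p S U : rev_sym p -> position (p * swap n) S U <-> position p S U.
Proof.
move=> sp; split; move=> [a [? ? ?]]; rewrite ?borel_of_swap // => h;
  by exists a; rewrite ?borel_of_swap.
Qed.

(** The conjugate by [c] of the root vector at (i, j) has as its entry (i, j) a product of two
    diagonal entries of triangular invertible matrices. It lies in [borel_of F p'], so this nonzero
    entry forbids p' j < p' i. *)
Lemma conj_le p p' c i j : rev_sym p -> orth c -> uptri 1 1 c ->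
  (Ad c @: borel_of F p)%VS = borel_of F p' ->
  (p i < p j)%N -> j != rev_ord i -> (p' i < p' j)%N.
Proof.
move=> sp oc uc cE ij nij.
have : c *m root_mx F i j *m adjm c \in borel_of F p'.
  by rewrite -cE mem_Ad // orthK // root_mx_borel_of // ltnW.
move=> /mem_borel_of[_ /(_ i j)]; rewrite mul_root_mx_mulE.
have cd k : c k k != 0 by apply: (uptri_diag (orth_unit oc) uc).
have -> : c i (rev_ord j) * adjm c (rev_ord i) j = 0.
  rewrite [adjm _ _ _]mxE rev_ordK.
  case: (ltngtP i (rev_ord j)) => [l|l|/val_inj e].
  - by rewrite (uc (rev_ord j)) ?mulr0 // !perm1.
  - by rewrite (uc i) ?mul0r // !perm1.
  - by rewrite e rev_ordK eqxx in nij.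
rewrite subr0 [adjm _ _ _]mxE => h.
rewrite ltn_neqAle; apply/andP; split.
  apply/eqP => /val_inj/perm_inj e; by rewrite e ltnn in ij.
rewrite leqNgt; apply/negP => /h/eqP; rewrite mulf_eq0 (negPf (cd i)) (negPf (cd _)).
by [].
Qed.

(** For i in S', coordinate i of c^-1 applied to the normal vector of S' reduces to its diagonal
    term, hence is nonzero. As i is not central, it then belongs to S. *)
Lemma conj_sub p p' c S S' : orth c -> uptri 1 1 c -> (Ad c @: borel_of F p)%VS = borel_of F p' ->
  admissible p S -> admissible p' S' -> c *m normal_vec F S = normal_vec F S' -> S' \subset S.
Proof.
move=> oc uc cE [sp _ _] [_ lS' aS'] cx; apply/fintype.subsetP => i iS'.
have li := lS' _ iS'.
have cd k : c k k != 0 by apply: (uptri_diag (orth_unit oc) uc).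
have ua := uptri_adj (rev_sym1 n) (rev_sym1 n) uc.
have ad k : adjm c k k != 0.
  by apply: (uptri_diag (orth_unit (orth_adj oc)) ua).
have : (adjm c *m normal_vec F S') i 0 = adjm c i i.
  rewrite mxE (bigD1 i) //= [normal_vec _ _ _ _]mxE iS' mulr1 big1 ?addr0 // => j ji.
  rewrite [normal_vec _ _ _ _]mxE; have [jS'|jS'] := boolP ((j \in S') || central j); last first.
    move: jS'; rewrite negb_or => /andP[/negPf-> /negPf cj].
    by rewrite [vref _ _ _ _]mxE cj mulr0.
  case: (ltngtP i j) => [ij|ij|/val_inj e]; last by rewrite e eqxx in ji.
    have p'ij := aS' _ _ iS' jS' ij.
    (* This torus element lies in every [borel_of]. Its conjugate has entry c i i * adjm c i j at
       (i, j), where [p'] demands zero; so adjm c i j vanishes. *)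
    have : c *m root_mx F i i *m adjm c \in borel_of F p'.
      by rewrite -cE mem_Ad // orthK // root_mx_borel_of.
    move=> /mem_borel_of[_ /(_ i j p'ij)]; rewrite mul_root_mx_mulE.
    have -> : adjm c (rev_ord i) j = 0.
      apply: ua; rewrite !perm1; case/orP: jS' => [/lS' lj|cj].
        exact: lower_lower_lt.
      by have /andP[] := lower_central_lt li cj.
    rewrite mulr0 subr0 => /eqP; rewrite mulf_eq0 (negPf (cd i)) => /eqP ->.
    by rewrite mul0r.
  by rewrite ua ?mul0r // ?perm1.
rewrite -cx mulmxA oc mul1mx !mxE; case: ifP => // _ h.
by have := ad i; rewrite mxE -h (lower_central li) eqxx.
Qed.

Lemma position_inj p p' S S' U : admissible p S -> admissible p' S' ->
  position p S U -> position p' S' U -> S = S' /\ (p' = p \/ p' = p * swap n)%g.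
Proof.
move=> aS aS' [a [oa ua av aU]] [a' [oa' ua' av' aU']].
have [sp _ _] := aS.
have uad := uptri_adj (rev_sym1 n) (rev_sym1 n) ua; have oad := orth_adj oa.
have uad' := uptri_adj (rev_sym1 n) (rev_sym1 n) ua'; have oad' := orth_adj oa'.
pose c := a' *m adjm a; pose d := a *m adjm a'.
have oc : orth c by apply: orthM.
have od : orth d by apply: orthM.
have uc : uptri 1 1 c by apply: uptri_mul uad.
have ud : uptri 1 1 d by apply: uptri_mul uad'.
have cE : (Ad c @: borel_of F p)%VS = borel_of F p' by rewrite AdM // -aU AdK.
have dE : (Ad d @: borel_of F p')%VS = borel_of F p by rewrite AdM // -aU' AdK.
have cx : c *m normal_vec F S = normal_vec F S'.
  by rewrite -av -av' /c -!mulmxA (mulmxA (adjm a)) oa mul1mx.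
have dx : d *m normal_vec F S' = normal_vec F S.
  by rewrite -av -av' /d -!mulmxA (mulmxA (adjm a')) oa' mul1mx.
split.
  apply/eqP; rewrite finset.eqEsubset (conj_sub od ud dE aS' aS dx).
  exact: (conj_sub oc uc cE aS aS' cx).
have [|e|e] := @almost_monotone n (p^-1 * p').
- move=> i j ij ji; rewrite !permM; apply: (conj_le sp oc uc cE).
    by rewrite !permKV.
  by apply: contra ji => /eqP e; rewrite -(permKV p j) e rev_symE // ?permKV.
- by left; rewrite -[p']mul1g -(mulgV p) -mulgA e mulg1.
- by right; rewrite -e mulVKg.
Qed.

(** Diagonal entries at dual positions are inverse to each other. A self-dual position occurs only
    for e_0, where fixing [vref] turns the sign into 1. *)
Lemma stab_vref_det b : stab_vref b -> \det b = 1.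
Proof.
move=> [ob ub bv]; rewrite -det_tr det_trig; last first.
  by apply/is_trig_mxP => i j ij; rewrite mxE ub // ?perm1.
have bb i : b (rev_ord i) (rev_ord i) * b i i = 1.
  have := congr1 (fun M : 'M_n => M i i) ob; rewrite !mxE eqxx (bigD1 i) //= big1 ?addr0 => [|j ji].
    by rewrite mxE.
  rewrite mxE; case: (ltngtP i j) => [ij|ij|/val_inj e]; last by rewrite e eqxx in ji.
    by rewrite [X in _ * X]ub ?mulr0 // ?perm1.
  by rewrite ub ?mul0r // ?perm1 /=; have := ltn_ord i; lia.
rewrite (bigID (fun i => i < rev_ord i)%N) /= mulrC (bigID (fun i => i == rev_ord i)) /=.
rewrite big1 => [|i /andP[_ /eqP e]]; last first.
  have ci : central i by rewrite /central -e andbb /lower -e; lia.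
  have vi : vref F n i 0 != 0 by rewrite vref_neq0.
  apply: (mulIf vi); rewrite mul1r [in LHS]mxE.
  have := congr1 (fun M : 'cV_n => M i 0) bv; rewrite /= => {2}<-.
  rewrite [RHS]mxE (bigD1 i) //= big1 ?addr0 // => j ji.
  have [cj|cj] := boolP (central j); last by rewrite [vref _ _ _ _]mxE (negPf cj) mulr0.
  by case: (central_eq ci cj) => ej; rewrite ?ej -?e eqxx in ji.
rewrite mul1r (reindex_inj rev_ord_inj) /=.
rewrite (eq_bigl (fun i : 'I_n => i < rev_ord i)%N); last first.
  move=> i; rewrite -val_eqE /=.
  by have := ltn_ord i; lia.
by rewrite -big_split big1 // => i _ /=; rewrite !mxE.
Qed.

End Orbits.

(** * Lie's theorem *)

Section Brackets.
Variables (F : fieldType) (n : nat).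
Implicit Types (X Y : 'M[F]_n) (U V W : {vspace 'M[F]_n}).

Lemma lie_product_min U V W :
  (forall X Y, X \in U -> Y \in V -> lie_bracket X Y \in W) -> (lie_product U V <= W)%VS.
Proof.
move=> h; apply/span_subvP => _ /allpairsP[[X Y] [/= XU YV ->]].
by apply: h; apply: vbasis_mem.
Qed.

Lemma mem_lie_product U V X Y : X \in U -> Y \in V -> lie_bracket X Y \in lie_product U V.
Proof.
move=> /coord_vbasis -> /coord_vbasis ->; rewrite /lie_bracket.
rewrite [X in X - _]mulmx_suml [X in _ - X]mulmx_sumr -sumrB; apply: memv_suml => i _.
rewrite [X in X - _]mulmx_sumr [X in _ - X]mulmx_suml -sumrB; apply: memv_suml => j _.
rewrite -!scalemxAl -!scalemxAr !scalerA [X in _ - X *: _]mulrC -scalerBr.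
apply/memvZ/memv_span/allpairsP.
by exists ((vbasis U)`_i, (vbasis V)`_j); rewrite !mem_nth ?size_tuple.
Qed.

Lemma lie_product_sub U : lie_subalgebra U -> (lie_product U U <= U)%VS.
Proof. exact: lie_product_min. Qed.

Lemma lie_product_subalgebra U : lie_subalgebra U -> lie_subalgebra (lie_product U U).
Proof.
move=> sU X Y /(subvP (lie_product_sub sU)) XU /(subvP (lie_product_sub sU)) YU.
exact: mem_lie_product.
Qed.

Lemma lie_product_mono U U' V V' :
  (U <= U')%VS -> (V <= V')%VS -> (lie_product U V <= lie_product U' V')%VS.
Proof.
move=> /subvP sU /subvP sV; apply: lie_product_min => X Y /sU XU /sV YV.
exact: mem_lie_product.
Qed.

End Brackets.

Section Lie.
Variables (F : numClosedFieldType) (n : nat).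
Implicit Types (X Y Z : 'M[F]_n) (U D : {vspace 'M[F]_n}) (v w : 'rV[F]_n).

Lemma trace_commutator r (A : 'M[F]_(r, n)) X Y (T : 'M_r) :
  row_free A -> (A *m X <= A)%MS -> (A *m Y <= A)%MS ->
  A *m lie_bracket X Y = T *m A -> \tr T = 0.
Proof.
move=> fA /submxP[B AX] /submxP[C AY] AZ.
have -> : T = B *m C - C *m B.
  apply: (row_free_inj fA); rewrite /= -AZ mulmxBr !mulmxA AX AY -!mulmxA AX AY.
  by rewrite mulmxBl !mulmxA.
by rewrite raddfB /= mxtrace_mulC subrr.
Qed.

Section Krylov.
Variables (X : 'M[F]_n) (w : 'rV[F]_n).

Definition krylov i : 'rV[F]_n := iter i (mulmxr X) w.
Definition krylov_mx d : 'M[F]_(d, n) := \matrix_(i < d) krylov i.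

Lemma krylov_sub i d : (i < d)%N -> (krylov i <= krylov_mx d)%MS.
Proof. by move=> lt; rewrite -(rowK (fun i : 'I_d => krylov i) (Ordinal lt)) row_sub. Qed.

Lemma krylov_mx_mono d e : (d <= e)%N -> (krylov_mx d <= krylov_mx e)%MS.
Proof.
by move=> de; apply/row_subP => i; rewrite rowK krylov_sub // (leq_trans _ de).
Qed.

Lemma krylov_mxX d : (krylov_mx d *m X <= krylov_mx d.+1)%MS.
Proof.
apply/row_subP => i; rewrite row_mul rowK; apply: (@krylov_sub i.+1).
by rewrite ltnS.
Qed.

Lemma krylov_free d :
  (forall i, (i < d)%N -> ~~ (krylov i <= krylov_mx i)%MS) -> row_free (krylov_mx d).
Proof.
move=> h; apply: inj_row_free => v vK.
case: (pickP (fun i => v 0 i != 0)) => [i0 vi0|v0]; last first.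
  by apply/rowP => i; rewrite mxE; apply/eqP; apply: negbFE; apply: v0.
case: (arg_maxnP (P := fun i => v 0 i != 0) (fun i : 'I_d => i : nat) vi0) => i vi imax.
case/negP: (h i (ltn_ord i)).
have -> : krylov i = (v 0 i)^-1 *: - \sum_(j < d | j != i) v 0 j *: krylov j.
  move: vK; rewrite mulmx_sum_row (bigD1 i) //= rowK => /eqP.
  rewrite addr_eq0 => /eqP e.
  rewrite (eq_bigr (fun j => v 0 j *: row j (krylov_mx d))) => [|j _]; last by rewrite rowK.
  by rewrite -e scalerA mulVf // scale1r.
rewrite scalemx_sub // eqmx_opp summx_sub // => j ji.
have [ij|ji'] := ltnP j i; first by rewrite scalemx_sub // krylov_sub.
have -> : v 0 j = 0; last by rewrite scale0r sub0mx.
apply/eqP/negPn/negP => /imax jle; case/eqP: ji; apply/val_inj/eqP.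
by rewrite eqn_leq ji' andbT; exact: jle.
Qed.

Lemma krylov_stable : w != 0 -> exists d,
  [/\ (0 < d)%N, row_free (krylov_mx d) & (krylov_mx d *m X <= krylov_mx d)%MS].
Proof.
move=> w0.
have ex : exists d, (krylov d <= krylov_mx d)%MS.
  have [|no] := pselect (exists d, (krylov d <= krylov_mx d)%MS); first by [].
  have /eqnP : row_free (krylov_mx n.+1).
    by apply: krylov_free => i _; apply/negP => h; apply: no; exists i.
  by move=> e; have := rank_leq_col (krylov_mx n.+1); rewrite e ltnn.
case: (ex_minnP ex) => d kd dmin; exists d; split.
- rewrite lt0n; apply/eqP => d0; move: kd; rewrite d0.
  by move=> /submxP[D]; rewrite (flatmx0 (krylov_mx 0)) mulmx0 /= => e; rewrite e eqxx in w0.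
- apply: krylov_free => i id; apply/negP => /dmin; by rewrite leqNgt id.
- apply: submx_trans (krylov_mxX d) _; apply/row_subP => i; rewrite rowK.
  have := ltn_ord i; rewrite ltnS leq_eqVlt => /orP[/eqP->//|]; exact: krylov_sub.
Qed.
End Krylov.

(** The Krylov space of [w] under [X] is stable under D, each Y acting on it by a triangular matrix
    with constant diagonal [lam Y]. The bracket of X and Y has trace 0 there, and the dimension is
    invertible in characteristic 0. *)
Lemma weight_invariance (D : {vspace 'M[F]_n}) (lam : 'M[F]_n -> F) X w : w != 0 ->
  (forall Y, Y \in D -> w *m Y = lam Y *: w) ->
  (forall Y, Y \in D -> lie_bracket X Y \in D) ->
  forall Y, Y \in D -> lam (lie_bracket X Y) = 0.
Proof.
move=> w0 hw hX Y YD; have [d [d0 fK sK]] := krylov_stable X w0.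
have tri i Z : Z \in D -> (krylov X w i *m Z - lam Z *: krylov X w i <= krylov_mx X w i)%MS.
  elim: i Z => [|i IH] Z ZD; first by rewrite /= hw // subrr sub0mx.
  have /= -> : krylov X w i.+1 *m Z - lam Z *: krylov X w i.+1 =
     (krylov X w i *m Z - lam Z *: krylov X w i) *m X +
      (krylov X w i *m lie_bracket X Z - lam (lie_bracket X Z) *: krylov X w i) +
      lam (lie_bracket X Z) *: krylov X w i.
    rewrite -addrA subrK /lie_bracket mulmxBr mulmxBl -scalemxAl !mulmxA.
    by rewrite [RHS]addrC addrA subrK.
  apply: addmx_sub; last by rewrite scalemx_sub // krylov_sub.
  apply: addmx_sub.
    exact: submx_trans (submxMr _ (IH _ ZD)) (krylov_mxX _ _ _).
  exact: submx_trans (IH _ (hX _ ZD)) (krylov_mx_mono _ _ (leqnSn _)).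
have sD Z : Z \in D -> (krylov_mx X w d *m Z <= krylov_mx X w d)%MS.
  move=> ZD; apply/row_subP => i; rewrite row_mul rowK.
  rewrite -[_ *m _](subrK (lam Z *: krylov X w i)).
  apply: addmx_sub; last by rewrite scalemx_sub // krylov_sub.
  exact: submx_trans (tri i Z ZD) (krylov_mx_mono _ _ (ltnW _)).
pose Z := lie_bracket X Y; have ZD : Z \in D by apply: hX.
(* As the Krylov rows are free, multiplying by [B] reads off coordinates in that basis; [T] is the
   matrix of the bracket. *)
pose B := pinvmx (krylov_mx X w d); pose T := krylov_mx X w d *m Z *m B.
have KB : krylov_mx X w d *m B = 1%:M by apply: mulmxVp.
have := @trace_commutator d (krylov_mx X w d) X Y T fK sK (sD _ YD).
rewrite /T mulmxKpV ?sD // => /(_ erefl).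
have krB (i : 'I_d) : krylov X w i *m B = row i 1%:M.
  by rewrite -KB row_mul rowK.
rewrite /mxtrace (eq_bigr (fun=> lam Z)) => [|i _].
  rewrite sumr_const card_ord => /eqP; rewrite mulrn_eq0 (gtn_eqF d0) /=.
  by move/eqP.
have -> : (krylov_mx X w d *m Z *m B) i i = (krylov X w i *m Z *m B) 0 i.
  by rewrite -[in RHS](rowK (fun i : 'I_d => krylov X w i) i) -!row_mul [RHS]mxE.
have /submxP[c cE] := tri i Z ZD.
rewrite -[krylov X w i *m Z](subrK (lam Z *: krylov X w i)) cE mulmxDl -scalemxAl krB.
suff c0 : (c *m krylov_mx X w i *m B) 0 i = 0 by rewrite [LHS]mxE c0 add0r !mxE eqxx mulr1.
have -> : c *m krylov_mx X w i *m B = \sum_(l < i) c 0 l *: (krylov X w l *m B).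
  rewrite [c *m krylov_mx X w i]mulmx_sum_row mulmx_suml; apply: eq_bigr => l _.
  by rewrite rowK scalemxAl.
rewrite summxE big1 // => l _.
have ld : (l < d)%N by apply: ltn_trans (ltn_ord i).
rewrite mxE (krB (Ordinal ld)) !mxE -val_eqE /= ltn_eqF ?mulr0 //.
Qed.

Lemma stable_span m (W : 'M[F]_(m, n)) U :
  (forall i : 'I_(\dim U), (W *m (vbasis U)`_i <= W)%MS) ->
  forall X, X \in U -> (W *m X <= W)%MS.
Proof.
move=> h X /coord_vbasis ->; rewrite mulmx_sumr summx_sub // => i _.
by rewrite -scalemxAr scalemx_sub.
Qed.

(** The stable space [W] is part of the statement because an orthogonal hyperplane is needed later.
    Induction on the derived length gives a weight [lam] of the derived algebra. On its weight space
    a bracket acts as a scalar of trace 0, so [lam] is zero on brackets and [U] acts by commuting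
    matrices. *)
Lemma lie_theorem k U m (W : 'M[F]_(m, n)) :
  lie_subalgebra U -> derived_series U k = 0%VS -> W != 0 ->
  (forall X, X \in U -> (W *m X <= W)%MS) ->
  exists v, [/\ v != 0, (v <= W)%MS & forall X, X \in U -> (v *m X <= v)%MS].
Proof.
elim: k U m W => [|k IH] U m W sU.
  rewrite /derived_series /= => -> W0 _.
  have /rowV0Pn[v vW v0] := W0; exists v; split=> // X.
  by rewrite memv0 => /eqP ->; rewrite mulmx0 sub0mx.
rewrite /derived_series iterSr -/(derived_series _ k) => solD W0 sW.
set D := lie_product U U in solD.
have sD := lie_product_subalgebra sU.
have DU : (D <= U)%VS := lie_product_sub sU.
have [v0 [v00 v0W v0D]] := IH D m W sD solD W0 (fun X XD => sW X (subvP DU X XD)).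
have [j vj] : exists j, v0 0 j != 0.
  case: (pickP (fun j => v0 0 j != 0)) => [j|no]; first by exists j.
  by case/eqP: v00; apply/rowP => j; rewrite mxE; apply/eqP/negPn; rewrite no.
pose lam Y := (v0 *m Y) 0 j / v0 0 j.
have lamE Y : Y \in D -> v0 *m Y = lam Y *: v0.
  move=> /v0D/sub_rVP[a e]; rewrite /lam e; congr (_ *: _).
  by rewrite mxE mulfK.
have br X Y : X \in U -> Y \in D -> lie_bracket X Y \in D.
  by move=> XU YD; apply: mem_lie_product => //; apply: subvP YD.
have lam0 X Y : X \in U -> Y \in D -> lam (lie_bracket X Y) = 0.
  move=> XU; apply: (weight_invariance v00 lamE) => Z; exact: br.
(* The weight space is cut out by a basis of D only. That suffices since [lam], read off at a fixed
   coordinate of [v0], is linear. *)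
pose W' := (W :&: \bigcap_(i < \dim D) eigenspace ((vbasis D)`_i) (lam (vbasis D)`_i))%MS.
have W'E Y : Y \in D -> W' *m Y = lam Y *: W'.
  move=> YD; rewrite (coord_vbasis YD) mulmx_sumr.
  rewrite (eq_bigr (fun i => (coord (vbasis D) i Y * lam (vbasis D)`_i) *: W')); last first.
    move=> i _; rewrite -scalemxAr -scalerA; congr (_ *: _).
    apply/eigenspaceP; apply: submx_trans (capmxSr _ _) _.
    by apply: (bigcapmx_inf i); rewrite ?submx_refl.
  rewrite -scaler_suml; congr (_ *: _).
  rewrite /lam mulmx_sumr summxE mulr_suml; apply: eq_bigr => i _.
  by rewrite -scalemxAr [in RHS]mxE mulrA.
have W'P p (A : 'M_(p, n)) : (A <= W)%MS -> (forall Y, Y \in D -> A *m Y = lam Y *: A) ->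
    (A <= W')%MS.
  move=> AW hA; rewrite sub_capmx AW; apply/sub_bigcapmxP => i _.
  by apply/eigenspaceP/hA/vbasis_mem; rewrite mem_nth ?size_tuple.
have W'0 : W' != 0.
  apply: contra v00 => /eqP e; have := W'P _ v0 v0W lamE.
  by rewrite e submx0.
have sW' X : X \in U -> (W' *m X <= W')%MS.
  move=> XU; apply: W'P.
    exact: submx_trans (submxMr _ (capmxSl _ _)) (sW _ XU).
  move=> Y YD; have -> : W' *m X *m Y = W' *m Y *m X + W' *m lie_bracket X Y.
    by rewrite /lie_bracket mulmxBr !mulmxA addrC subrK.
  by rewrite (W'E _ (br _ _ XU YD)) lam0 // scale0r addr0 W'E // scalemxAl.
pose A := row_base W'; pose r := \rank W'.
have fA : row_free A := row_base_free W'.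
have sA X : X \in U -> (A *m X <= A)%MS.
  move=> XU; rewrite (submx_trans (submxMr _ _) (submx_trans (sW' X XU) _)) //;
  by rewrite eq_row_base.
have AE Y : Y \in D -> A *m Y = lam Y *: A.
  move=> YD; have /submxP[B ->] : (A <= W')%MS by rewrite eq_row_base.
  by rewrite -mulmxA W'E // scalemxAr.
have r0 : (0 < r)%N by rewrite lt0n mxrank_eq0.
have lamC X Y : X \in U -> Y \in U -> lam (lie_bracket X Y) = 0.
  move=> XU YU; have ZD := mem_lie_product XU YU.
  have := @trace_commutator r A X Y (lam (lie_bracket X Y))%:M fA (sA _ XU) (sA _ YU).
  rewrite mul_scalar_mx AE // mxtrace_scalar => /(_ erefl)/eqP.
  by rewrite mulrn_eq0 (gtn_eqF r0) /= => /eqP.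
pose C X := A *m X *m pinvmx A.
have CA X : X \in U -> C X *m A = A *m X by move=> XU; rewrite mulmxKpV ?sA.
have CC X Y : X \in U -> Y \in U -> C X *m C Y *m A = A *m (X *m Y).
  by move=> XU YU; rewrite -[LHS]mulmxA CA // mulmxA CA // mulmxA.
have comC : {in [seq C X | X <- vbasis U] &, forall B1 B2, comm_mx B1 B2}.
  move=> _ _ /mapP[X /vbasis_mem XU ->] /mapP[Y /vbasis_mem YU ->].
  apply: (row_free_inj fA); rewrite /= !CC //.
  apply/eqP; rewrite -subr_eq0 -mulmxBr -/(lie_bracket X Y).
  by rewrite AE ?lamC ?scale0r // mem_lie_product.
have [v vn0 /allP vC] := common_eigenvector r0 comC.
exists (v *m A); split.
- by rewrite mulmx_free_eq0.
- apply: submx_trans (submxMl _ _) _; rewrite eq_row_base; exact: capmxSl.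
apply: stable_span => i; set X := _`_i.
have Xb : X \in tval (vbasis U) by rewrite mem_nth ?size_tuple.
rewrite -mulmxA -CA; last exact: vbasis_mem.
rewrite mulmxA submxMr //; apply: vC; exact: map_f.
Qed.

End Lie.

(** * Isotropic flags *)

Section Homomorphisms.
Variables (F : fieldType) (n m : nat) (phi : 'Hom('M[F]_n, 'M[F]_m)).
Variable U : {vspace 'M[F]_n}.
Hypothesis sU : lie_subalgebra U.
Hypothesis phiB : forall X Y, X \in U -> Y \in U ->
  phi (lie_bracket X Y) = lie_bracket (phi X) (phi Y).

Lemma derived_series_sub k : (derived_series U k <= U)%VS.
Proof.
elim: k => [|k IH]; first exact: subvv.
exact: subv_trans (lie_product_mono IH IH) (lie_product_sub sU).
Qed.

Lemma limg_subalgebra : lie_subalgebra (phi @: U).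
Proof.
move=> _ _ /memv_imgP[X XU ->] /memv_imgP[Y YU ->].
by rewrite -phiB // memv_img // sU.
Qed.

Lemma limg_derived k : (derived_series (phi @: U) k <= phi @: derived_series U k)%VS.
Proof.
elim: k => [|k IH]; first exact: subvv.
apply: subv_trans (lie_product_mono IH IH) _; apply: lie_product_min.
move=> _ _ /memv_imgP[X XU ->] /memv_imgP[Y YU ->].
have sk := subvP (derived_series_sub k).
by rewrite -phiB ?sk // memv_img // mem_lie_product.
Qed.

Lemma limg_solvable k : derived_series U k = 0%VS -> derived_series (phi @: U) k = 0%VS.
Proof. by move=> h; apply/eqP; rewrite -subv0 -(limg0 phi) -h limg_derived. Qed.

End Homomorphisms.

(** * Isotropic vectors and reflections *)

Section Quadric.
Variables (F : numClosedFieldType) (n : nat).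
Implicit Types (u v w z : 'rV[F]_n) (g A X : 'M[F]_n) (U : {vspace 'M[F]_n}).

Definition dual_col w : 'cV[F]_n := \col_i w 0 (rev_ord i).
Definition rform u w : F := (u *m dual_col w) 0 0.

Lemma rformE u w : rform u w = \sum_i u 0 i * w 0 (rev_ord i).
Proof. by rewrite /rform mxE; apply: eq_bigr => i _; rewrite mxE. Qed.

Lemma rformC u w : rform u w = rform w u.
Proof.
rewrite !rformE (reindex_inj rev_ord_inj); apply: eq_bigr => i _.
by rewrite rev_ordK mulrC.
Qed.

Lemma rformDl u v w : rform (u + v) w = rform u w + rform v w.
Proof. by rewrite /rform mulmxDl mxE. Qed.

Lemma rformZl a u w : rform (a *: u) w = a * rform u w.
Proof. by rewrite /rform -scalemxAl mxE. Qed.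

Lemma rformDr u v w : rform w (u + v) = rform w u + rform w v.
Proof. by rewrite ![rform w _]rformC rformDl. Qed.

Lemma rformZr a u w : rform w (a *: u) = a * rform w u.
Proof. by rewrite ![rform w _]rformC rformZl. Qed.

Definition rformE2 := (rformDl, rformZl, rformDr, rformZr).

Lemma dual_colM w A : dual_col (w *m A) = adjm A *m dual_col w.
Proof.
apply/matrixP => i j; rewrite !mxE (reindex_inj rev_ord_inj) /=.
by apply: eq_bigr => k _; rewrite !mxE mulrC.
Qed.

Lemma rform_adj u w A : rform (u *m A) w = rform u (w *m adjm A).
Proof. by rewrite /rform dual_colM adjmK mulmxA. Qed.

(** A skew matrix can have a non-isotropic eigenvector only for the eigenvalue 0. *)
Lemma rform_skew v X a : adjm X = - X -> v *m X = a *: v -> a * rform v v = 0.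
Proof.
move=> sX vX; have := rform_adj v v X.
rewrite vX sX mulmxN vX -scaleNr rformZl rformZr mulNr => /eqP.
by rewrite -addr_eq0 -mulr2n mulrn_eq0 => /eqP.
Qed.

(** The reflection in the hyperplane orthogonal to v - w exchanges the two vectors. It exists
    because v - w has norm -2 (v, w), which is nonzero. *)
Lemma reflection v w : rform v v = 0 -> rform w w = 0 -> rform v w != 0 ->
  exists2 g, orth g & w *m g = v.
Proof.
move=> qv qw vw; pose u := v - w.
have qu : rform u u = - 2 * rform v w.
  by rewrite /u -scaleN1r !rformE2 qv qw (rformC w v); ring.
have qu0 : rform u u != 0 by rewrite qu mulf_neq0 // oppr_eq0 pnatr_eq0.
pose P := dual_col u *m u.
have uP z : z *m P = rform z u *: u.
  by rewrite mulmxA [z *m _]mx11_scalar mul_scalar_mx.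
have aP : adjm P = P.
  apply/matrixP => i j; rewrite mxE !mxE !big_ord1 !mxE rev_ordK mulrC; congr (_ * _).
have PP : P *m P = rform u u *: P.
  by rewrite {1}/P -mulmxA uP -scalemxAr.
pose c := 2 / rform u u.
exists (1%:M - c *: P).
  rewrite /orth adjmD adjm1 adjmN adjmZ aP mulmxBr mulmx1 mulmxBl mul1mx -scalemxAl -scalemxAr PP.
  rewrite !scalerA -scalerBl -addrA -opprD -scalerDl.
  have -> : c + (c - c * c * rform u u) = 0 by rewrite /c; field.
  by rewrite scale0r subr0.
rewrite mulmxBr mulmx1 -scalemxAr uP scalerA.
have -> : c * rform w u = -1.
  rewrite /c qu /u -scaleN1r !rformE2 qw (rformC w v); field.
  by rewrite vw.
by rewrite scaleN1r opprK /u addrC subrK.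
Qed.

End Quadric.

Section Witt.
Variables (F : numClosedFieldType) (n : nat).
Implicit Types (u v w z : 'rV[F]_n.+2).

Let e0 : 'rV[F]_n.+2 := delta_mx 0 ord0.
Definition emax : 'rV[F]_n.+2 := delta_mx 0 ord_max.

Lemma rev0 : rev_ord (ord0 : 'I_n.+2) = ord_max.
Proof. by apply: val_inj; rewrite /= subn1. Qed.

Lemma revmax : rev_ord (ord_max : 'I_n.+2) = ord0.
Proof. by apply: val_inj; rewrite /= subnn. Qed.

Lemma rform_delta v j : rform v (delta_mx 0 j) = v 0 (rev_ord j).
Proof.
rewrite rformE (bigD1 (rev_ord j)) //= big1 ?addr0 => [|i ij].
  by rewrite mxE rev_ordK !eqxx mulr1.
rewrite mxE /=; case: eqP => [e|]; last by rewrite mulr0.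
by rewrite -e rev_ordK eqxx in ij.
Qed.

Lemma deltaE i j : (delta_mx 0 j : 'rV[F]_n.+2) 0 i = (i == j)%:R.
Proof. by rewrite mxE eqxx. Qed.

Lemma witt v : v != 0 -> rform v v = 0 -> exists2 g, orth g & emax *m g = v.
Proof.
move=> v0 qv.
have qm : rform emax emax = 0 by rewrite rform_delta revmax deltaE.
have [vn0|] := eqVneq (v 0 ord0) 0; last first.
  by move=> vn0; apply: reflection => //; rewrite rform_delta revmax.
(* If [v] is orthogonal to [emax], two reflections are composed, through an isotropic [z] orthogonal
   to neither. *)
suff [z [qz zv z0]] : exists z, [/\ rform z z = 0, rform v z != 0 & z 0 ord0 != 0].
  have [g og gE] := reflection qv qz zv.
  have [h oh hE] : exists2 h, orth h & emax *m h = z.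
    by apply: reflection => //; rewrite rform_delta revmax.
  by exists (h *m g); [exact: orthM | rewrite mulmxA hE].
have [vm|vm] := eqVneq (v 0 ord_max) 0; last first.
  by exists e0; rewrite !rform_delta rev0 !deltaE; split=> //; rewrite oner_eq0.
have [r vr] : exists r, v 0 r != 0.
  case: (pickP (fun j => v 0 j != 0)) => [j|no]; first by exists j.
  by case/eqP: v0; apply/rowP => j; rewrite mxE; apply/eqP/negPn; rewrite no.
have r0 : r != ord0 by apply: contra vr => /eqP ->; rewrite vn0.
have rm : r != ord_max by apply: contra vr => /eqP ->; rewrite vm.
have r0' : rev_ord r != ord0 by rewrite -revmax (inj_eq rev_ord_inj).
have rm' : rev_ord r != ord_max by rewrite -rev0 (inj_eq rev_ord_inj).
(* [b] is the norm of the basis vector at [rev_ord r], which is 1 if r is self-dual; the multiple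
   -b/2 of [emax], paired with [e0], cancels it. *)
pose b : F := (r == rev_ord r)%:R.
exists (e0 + (1 *: delta_mx 0 (rev_ord r) + - (b / 2) *: emax)).
rewrite !rformE2 /e0 /emax !rform_delta !mxE /= rev0 revmax rev_ordK.
rewrite vm vn0 eqxx (negPf r0) (negPf rm) ![_ == rev_ord r]eq_sym (negPf r0') (negPf rm').
rewrite [rev_ord r == r]eq_sym -/b /=; split; last 2 first.
- by rewrite !mulr0 mul1r add0r addr0.
- by rewrite !mulr0 !addr0 oner_eq0.
by rewrite eqxx /=; field.
Qed.
End Witt.

Lemma isotropic_eigenvector (F : numClosedFieldType) n (U : {vspace 'M[F]_n.+2}) k :
  lie_subalgebra U -> derived_series U k = 0%VS ->
  (forall X, X \in U -> adjm X = - X) ->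
  exists v : 'rV[F]_n.+2, [/\ v != 0, rform v v = 0 &
    forall X, X \in U -> exists a, v *m X = a *: v].
Proof.
move=> sU solU soU.
have [v1 [v10 _ v1U]] : exists v : 'rV[F]_n.+2,
    [/\ v != 0, (v <= (1%:M : 'M[F]_n.+2))%MS & forall X, X \in U -> (v *m X <= v)%MS].
  by apply: (lie_theorem sU solU) => [|X _]; rewrite ?submx1 // oner_eq0.
have [q1|q1] := eqVneq (rform v1 v1) 0.
  by exists v1; split=> // X /v1U/sub_rVP.
have kill v X : X \in U -> rform v v != 0 -> (v *m X <= v)%MS -> v *m X = 0.
  move=> XU qv /sub_rVP[a e]; have := rform_skew (soU _ XU) e.
  by move=> /eqP; rewrite mulf_eq0 (negPf qv) orbF e => /eqP ->; rewrite scale0r.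
have [v2 [v20 v2W v2U]] : exists v : 'rV[F]_n.+2,
    [/\ v != 0, (v <= kermx (dual_col v1))%MS & forall X, X \in U -> (v *m X <= v)%MS].
  (* The hyperplane orthogonal to [v1] is nonzero since the dimension is at least 2, and stable
     since [U] is skew and kills [v1]. *)
  apply: (lie_theorem sU solU) => [|X XU].
    rewrite -mxrank_eq0 mxrank_ker; have := rank_leq_col (dual_col v1); lia.
  apply/sub_kermxP; rewrite -mulmxA.
  have -> : X *m dual_col v1 = dual_col (v1 *m adjm X) by rewrite dual_colM adjmK.
  rewrite soU // mulmxN kill ?v1U // oppr0.
  by rewrite (_ : dual_col 0 = 0) ?mulmx0 //; apply/matrixP => i j; rewrite !mxE.
have [q2|q2] := eqVneq (rform v2 v2) 0.
  by exists v2; split=> // X /v2U/sub_rVP.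
have v21 : rform v2 v1 = 0 by rewrite /rform (sub_kermxP v2W) mxE.
(* Both eigenvectors are now killed by [U], hence so is every combination; this [c] makes one of
   them isotropic. *)
pose c := sqrtC (- rform v1 v1 / rform v2 v2).
have cc : c * c = - rform v1 v1 / rform v2 v2 by rewrite -expr2 sqrtCK.
exists (v1 + c *: v2); split.
- apply: contra q1 => /eqP e; have : rform (v1 + c *: v2) v1 = 0.
    by rewrite e /rform mul0mx mxE.
  by rewrite !rformE2 v21 mulr0 addr0 => ->.
- rewrite !rformE2 v21 rformC v21 !mulr0 addr0 add0r mulrA cc.
  by rewrite divfK // subrr.
- move=> X XU; exists 0; rewrite scale0r mulmxDl -scalemxAl.
  by rewrite (kill v1) ?v1U // (kill v2) ?v2U // scaler0 addr0.
Qed.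

(** * The parabolic subalgebra of an isotropic line and its middle block *)

Section Middle.
Variables (F : fieldType) (n : nat).
Implicit Types (X Y A B : 'M[F]_n.+2) (g : 'M[F]_n).

Definition mid (i : 'I_n) : 'I_n.+2 := lift ord0 (lift ord_max i).

Lemma val_mid i : mid i = i.+1 :> nat.
Proof. by rewrite /mid /= /bump /= leqNgt ltn_ord. Qed.

Variant mid_spec : 'I_n.+2 -> Prop :=
  | MidFirst : mid_spec ord0 | MidLast : mid_spec ord_max | MidMid i : mid_spec (mid i).

Lemma midP i : mid_spec i.
Proof.
case: (unliftP ord0 i) => [j|] ->; last exact: MidFirst.
case: (unliftP ord_max j) => [k|] ->; first exact: (MidMid k).
by rewrite (_ : lift _ _ = ord_max); [exact: MidLast | apply: val_inj].
Qed.

Lemma rev_mid i : rev_ord (mid i) = mid (rev_ord i).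
Proof.
apply: val_inj; rewrite [RHS]val_mid; change (n.+2 - (mid i).+1 = (n - i.+1).+1)%N.
by rewrite val_mid; have := ltn_ord i; lia.
Qed.

Lemma mid_inj : injective mid.
Proof. by move=> i j /lift_inj/lift_inj. Qed.

Lemma mid_eq0 i : (mid i == ord0) = false.
Proof. by rewrite eq_sym; apply/negbTE; apply: neq_lift. Qed.

Lemma mid_eqmax i : (mid i == ord_max) = false.
Proof.
rewrite -val_eqE; change ((nat_of_ord (mid i) == n.+1) = false).
by rewrite val_mid; have := ltn_ord i; lia.
Qed.

Lemma big_mid (f : 'I_n.+2 -> F) : \sum_i f i = f ord0 + \sum_i f (mid i) + f ord_max.
Proof.
rewrite big_ord_recl big_ord_recr /= addrA; congr (_ + _ + f _); last by apply: val_inj.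
apply: eq_bigr => i _; congr f; apply: val_inj.
exact/esym/val_mid.
Qed.

(** For skew matrices this is the stabilizer of the isotropic line spanned by the last basis row
    vector e; [midmx] is then the action on the orthogonal of e modulo e. *)
Definition parabolic A := [/\ forall i, A (mid i) ord0 = 0, forall i, A ord_max (mid i) = 0
  & A ord_max ord0 = 0].

Definition midmx A : 'M[F]_n := mxsub mid mid A.

Lemma midmxM A B : parabolic A -> parabolic B -> midmx (A *m B) = midmx A *m midmx B.
Proof.
move=> [a1 a2 a3] [b1 b2 b3]; apply/matrixP => i j; rewrite !mxE big_mid a1 b2 mul0r mulr0.
by rewrite add0r addr0; apply: eq_bigr => k _; rewrite !mxE.
Qed.

Lemma parabolicM A B : parabolic A -> parabolic B -> parabolic (A *m B).
Proof.
move=> [a1 a2 a3] [b1 b2 b3]; split=> [i|i|]; rewrite mxE big_mid.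
- rewrite a1 mul0r b3 mulr0 addr0 add0r big1 // => k _; by rewrite b1 mulr0.
- rewrite a3 mul0r b2 mulr0 addr0 add0r big1 // => k _; by rewrite a2 mul0r.
- rewrite a3 mul0r b3 mulr0 addr0 add0r big1 // => k _; by rewrite a2 mul0r.
Qed.

Lemma midmx_adj A : midmx (adjm A) = adjm (midmx A).
Proof. by apply/matrixP => i j; rewrite !mxE !rev_mid. Qed.

Lemma midmxB A B : midmx (A - B) = midmx A - midmx B.
Proof. by apply/matrixP => i j; rewrite !mxE. Qed.

Lemma midmxN A : midmx (- A) = - midmx A.
Proof. by apply/matrixP => i j; rewrite !mxE. Qed.

Lemma midmx_linear : linear midmx.
Proof. by move=> a A B; apply/matrixP => i j; rewrite !mxE. Qed.
HB.instance Definition _ :=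
  GRing.isLinear.Build F 'M[F]_n.+2 'M[F]_n *:%R midmx midmx_linear.

Definition liftmx g : 'M[F]_n.+2 := \matrix_(i, j)
  if [pick a | i == mid a] is Some a then
    if [pick b | j == mid b] is Some b then g a b else 0
  else (i == j)%:R.

Lemma pick_mid i : [pick a | mid i == mid a] = Some i.
Proof. by case: pickP => [a /eqP/mid_inj->|/(_ i)]; rewrite ?eqxx. Qed.

Lemma pick_mid0 : [pick a | ord0 == mid a] = None.
Proof. by case: pickP => // a; rewrite eq_sym mid_eq0. Qed.

Lemma pick_midmax : [pick a | ord_max == mid a] = None.
Proof. by case: pickP => // a; rewrite eq_sym mid_eqmax. Qed.

Lemma liftmxE g : [/\ forall i j, liftmx g (mid i) (mid j) = g i j,
  parabolic (liftmx g), forall i, liftmx g ord0 (mid i) = 0,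
  forall i, liftmx g (mid i) ord_max = 0 &
  [/\ liftmx g ord0 ord0 = 1, liftmx g ord0 ord_max = 0 & liftmx g ord_max ord_max = 1]].
Proof.
split; [|split|..|split].
- by move=> i j; rewrite mxE !pick_mid.
- by move=> i; rewrite mxE pick_mid pick_mid0.
- by move=> i; rewrite mxE pick_midmax eq_sym mid_eqmax.
- by rewrite mxE pick_midmax.
- by move=> i; rewrite mxE pick_mid0 eq_sym mid_eq0.
- by move=> i; rewrite mxE pick_mid pick_midmax.
- by rewrite mxE pick_mid0 eqxx.
- by rewrite mxE pick_mid0.
- by rewrite mxE pick_midmax eqxx.
Qed.

Lemma liftmxK g : midmx (liftmx g) = g.
Proof. by apply/matrixP => i j; rewrite mxE; have [->] := liftmxE g. Qed.

Lemma liftmx_adj g : adjm (liftmx g) = liftmx (adjm g).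
Proof.
have [h1 [h2 h3 h4] h5 h6 [h7 h8 h9]] := liftmxE g.
have [k1 [k2 k3 k4] k5 k6 [k7 k8 k9]] := liftmxE (adjm g).
apply/matrixP => i j; rewrite mxE.
case: (midP i) => [||a]; case: (midP j) => [||b];
  rewrite ?rev0 ?revmax ?rev_mid ?h1 ?h2 ?h3 ?h4 ?h5 ?h6 ?h7 ?h8 ?h9
          ?k1 ?k2 ?k3 ?k4 ?k5 ?k6 ?k7 ?k8 ?k9 //.
by rewrite mxE.
Qed.

Lemma liftmx_orth g : orth g -> orth (liftmx g).
Proof.
move=> og; rewrite /orth liftmx_adj.
have [h1 [h2 h3 h4] h5 h6 [h7 h8 h9]] := liftmxE g.
have [k1 [k2 k3 k4] k5 k6 [k7 k8 k9]] := liftmxE (adjm g).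
have e0 i : (ord0 == mid i) = false by rewrite eq_sym mid_eq0.
have em i : (ord_max == mid i) = false by rewrite eq_sym mid_eqmax.
apply/matrixP => i j; rewrite mxE big_mid [RHS]mxE.
case: (midP i) => [||a]; case: (midP j) => [||b];
  rewrite ?h2 ?h3 ?h4 ?h5 ?h6 ?h7 ?h8 ?h9 ?k1 ?k2 ?k3 ?k4 ?k5 ?k6 ?k7 ?k8 ?k9
    ?mul0r ?mulr0 ?mulr1 ?add0r ?addr0 ?eqxx ?mid_eq0 ?mid_eqmax ?e0 ?em //.
all: try by rewrite big1 ?addr0 ?add0r // => l _; rewrite ?h2 ?h3 ?h5 ?h6 ?k3 ?k5 ?mul0r ?mulr0.
have := congr1 (fun M : 'M_n => M a b) og.
rewrite !mxE (inj_eq mid_inj) => <-.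
by apply: eq_bigr => l _; rewrite k1 h1.
Qed.

Lemma parabolic_uptri A : parabolic A -> uptri 1 1 (midmx A) -> uptri 1 1 A.
Proof.
move=> [a1 a2 a3] uA i j; rewrite !perm1.
case: (midP i) => [||a]; case: (midP j) => [||b] //; rewrite ?ltnn ?a1 ?a2 ?a3 //.
- by move=> lt; have := leq_trans lt (leq_ord (mid a)); rewrite ltnn.
- by rewrite !val_mid ltnS => ba; have := uA a b; rewrite mxE !perm1; apply.
Qed.

End Middle.

Lemma triangularization (F : numClosedFieldType) n (U : {vspace 'M[F]_n}) k :
  lie_subalgebra U -> derived_series U k = 0%VS ->
  (forall X, X \in U -> adjm X = - X) ->
  exists2 g, orth g & forall X, X \in U -> uptri 1 1 (g *m X *m adjm g).
Proof.
have [m] := ubnP n; elim: m n U => // m IH [|[|n]] U nm sU solU soU.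
- by exists 1%:M; [exact: orth1 | move=> X _ []].
- by exists 1%:M; [exact: orth1 | move=> X _ i j; rewrite !ord1 ltnn].
have [v [v0 qv vU]] := isotropic_eigenvector sU solU soU.
have [g og gE] := witt v0 qv.
have parU X : X \in U -> parabolic (g *m X *m adjm g).
  move=> XU; set Y := _ *m _.
  have sY : adjm Y = - Y by rewrite adjm_conj (soU X) // mulmxN mulNmx.
  have [a va] := vU X XU.
  have eY : emax F n *m Y = a *: emax F n.
    by rewrite !mulmxA gE va -gE -!scalemxAl -mulmxA orthV // mulmx1.
  have Ym j : Y ord_max j = a * (j == ord_max)%:R.
    have -> : Y ord_max j = (emax F n *m Y) 0 j by rewrite /emax -rowE [RHS]mxE.
    by rewrite eY !mxE eqxx.
  (* Skewness carries the shape of the last row over to the first column. *)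
  have Y0 i : Y i ord0 = - (a * (rev_ord i == ord_max)%:R).
    have := congr1 (fun M : 'M_n.+2 => M i ord0) sY; rewrite mxE [RHS]mxE rev0 Ym.
    by move=> ->; rewrite opprK.
  split=> [i|i|]; rewrite ?Ym ?Y0.
  - by rewrite rev_mid mid_eqmax mulr0 oppr0.
  - by rewrite mid_eqmax mulr0.
  - by rewrite mulr0.
pose phi := (linfun (@midmx F n) \o Ad g)%VF.
have phiE X : phi X = midmx (g *m X *m adjm g).
  by rewrite comp_lfunE AdE orth_inv // lfunE.
have phiB X Y : X \in U -> Y \in U -> phi (lie_bracket X Y) = lie_bracket (phi X) (phi Y).
  move=> XU YU; rewrite !phiE /lie_bracket -!midmxM -?midmxB; try exact: parU.
  congr midmx; rewrite mulmxBr mulmxBl !mulmxA.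
  by congr (_ - _); congr (_ *m _); rewrite -!mulmxA (mulmxA (adjm g)) og mul1mx.
have [||||g' og' uU] := IH n (phi @: U)%VS.
- by apply: leq_trans (nm : (n.+2 <= m)%N); exact: leqnSn.
- exact: limg_subalgebra.
- exact: limg_solvable solU.
- move=> _ /memv_imgP[X XU ->]; rewrite phiE -midmx_adj adjm_conj (soU X) // mulmxN mulNmx.
  exact: midmxN.
exists (liftmx g' *m g); first by apply: orthM => //; apply: liftmx_orth.
move=> X XU; have := uU _ (memv_img phi XU); rewrite phiE.
have [_ pl _ _ _] := liftmxE g'; have [_ pl' _ _ _] := liftmxE (adjm g').
rewrite adjmM liftmx_adj !mulmxA -(mulmxA (liftmx g')) -(mulmxA (liftmx g') (g *m X)) => h.
move: (g *m X *m adjm g) (parU X XU) h => Y pY h.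
apply: parabolic_uptri; first by apply: parabolicM => //; apply: parabolicM.
by rewrite !midmxM ?liftmxK //; exact: parabolicM.
Qed.

(** * Classification of the Borel subalgebras *)

Section BorelSubalgebras.
Variables (F : numClosedFieldType) (n : nat).
Implicit Types (X Y g h : 'M[F]_n) (U V : {vspace 'M[F]_n}).

Lemma lie_product_closed (P : 'M[F]_n -> Prop) U V :
  P 0 -> (forall a X Y, P X -> P Y -> P (a *: X + Y)) ->
  (forall X Y, X \in U -> Y \in V -> P (lie_bracket X Y)) ->
  forall X, X \in lie_product U V -> P X.
Proof.
move=> P0 Pl Pb X; rewrite /lie_product; set s := [seq _ | _ <- _, _ <- _].
have Ps Y : Y \in s -> P Y.
  by move=> /allpairsP[[A B] [/= AU BV ->]]; apply: Pb; apply: vbasis_mem.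
move=> /(@coord_span _ _ _ (in_tuple s)) ->.
elim/big_rec: _ => // i Y _ PY; apply: Pl => //.
by apply: Ps; rewrite mem_nth.
Qed.

Lemma borel_of_subalgebra p : lie_subalgebra (borel_of F p : {vspace 'M[F]_n}).
Proof.
move=> X Y /mem_borel_of[aX uX] /mem_borel_of[aY uY]; apply/mem_borel_of; split.
  by rewrite adjmD adjmN !adjmM aX aY !mulNmx !mulmxN !opprK opprB.
by apply: uptriD; [|apply: uptriN]; apply: uptri_mul; eassumption.
Qed.

Definition band k X := forall i j : 'I_n, (j < i + k)%N -> X i j = 0.

Lemma band_mul k l X Y : band k X -> band l Y -> band (k + l) (X *m Y).
Proof.
move=> hX hY i j ij; rewrite mxE big1 // => r _.
have [lt|ge] := ltnP r (i + k); first by rewrite hX ?mul0r.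
by rewrite hY ?mulr0 //; apply: leq_trans ij _; lia.
Qed.

Lemma bandS k l X : (k <= l)%N -> band l X -> band k X.
Proof. by move=> kl hX i j ij; apply: hX; apply: leq_trans ij _; rewrite leq_add2l. Qed.

(** The first bracket clears the diagonal, where products of triangular matrices commute. From then
    on the widths of bands add, so that each step gains at least one superdiagonal. *)
Lemma derived_borel_of k X : X \in derived_series (borel_of F 1) k.+1 -> band k.+1 X.
Proof.
have lin l a Y Z : band l Y -> band l Z -> band l (a *: Y + Z).
  by move=> hY hZ i j ij; rewrite !mxE hY // hZ // mulr0 addr0.
have z l : band l 0 by move=> i j _; rewrite mxE.
elim: k X => [|k IH].
  apply: (@lie_product_closed (band 1) (borel_of F 1) (borel_of F 1)) => // [a Y Z|]; first exact: lin.
  move=> {}X Y /mem_borel_of[_ uX] /mem_borel_of[_ uY].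
  have b0 Z : uptri 1 1 Z -> band 0 Z.
    by move=> uZ i j; rewrite addn0 => ij; apply: uZ; rewrite !perm1.
  move=> i j; rewrite addn1 ltnS leq_eqVlt => /orP[/eqP/val_inj ->|ij].
    have dg A B : uptri 1 1 A -> uptri 1 1 B -> (A *m B) i i = A i i * B i i.
      move=> uA uB; rewrite mxE (bigD1 i) //= big1 ?addr0 // => r ri.
      case: (ltngtP i r) => [lt|lt|/val_inj e]; last by rewrite e eqxx in ri.
        by rewrite [B _ _]uB ?mulr0 // !perm1.
      by rewrite uA ?mul0r // !perm1.
    by rewrite mxE [X in _ + X]mxE !dg // mulrC subrr.
  have ij0 : (j < i + (0 + 0))%N by rewrite !addn0.
  rewrite mxE [X in _ + X]mxE (band_mul (b0 _ uX) (b0 _ uY) ij0).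
  by rewrite (band_mul (b0 _ uY) (b0 _ uX) ij0) subrr.
apply: (@lie_product_closed (band k.+2) (derived_series (borel_of F 1) k.+1)
  (derived_series (borel_of F 1) k.+1)) => // [a Y Z|].
  exact: lin.
move=> {}X Y /IH hX /IH hY.
have s : (k.+2 <= k.+1 + k.+1)%N by lia.
move=> i j ij; rewrite mxE [X in _ + X]mxE (bandS s (band_mul hX hY) ij).
by rewrite (bandS s (band_mul hY hX) ij) subrr.
Qed.

Lemma borel_of_solvable : lie_solvable (borel_of F 1 : {vspace 'M[F]_n}).
Proof.
exists n.+1; apply/eqP; rewrite -subv0; apply/subvP => X /derived_borel_of hX.
rewrite memv0; apply/eqP/matrixP => i j; rewrite hX ?mxE //.
by rewrite addnS ltnS; have := ltn_ord j; lia.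
Qed.

Lemma Ad_lie_bracket g X Y : orth g -> Ad g (lie_bracket X Y) = lie_bracket (Ad g X) (Ad g Y).
Proof.
move=> og; rewrite !AdE orth_inv // /lie_bracket mulmxBr mulmxBl !mulmxA.
by congr (_ - _); congr (_ *m _); rewrite -!mulmxA (mulmxA (adjm g)) og mul1mx.
Qed.

Lemma solvable_subalgebra_Ad g U : orth g ->
  solvable_subalgebra_so U -> solvable_subalgebra_so (Ad g @: U)%VS.
Proof.
move=> og [sU aU [k solU]].
have brU X Y : X \in U -> Y \in U -> Ad g (lie_bracket X Y) = lie_bracket (Ad g X) (Ad g Y).
  by move=> _ _; apply: Ad_lie_bracket.
split; last 2 first.
- exact: limg_subalgebra.
- by exists k; apply: limg_solvable.
move=> _ /= /memv_imgP[X XU ->]; apply/soP.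
have /soP aX := sU X XU.
by rewrite AdE orth_inv // adjm_conj aX mulmxN mulNmx.
Qed.

Lemma borel_of_solvable_subalgebra : solvable_subalgebra_so (borel_of F 1 : {vspace 'M[F]_n}).
Proof.
split; [|exact: borel_of_subalgebra|exact: borel_of_solvable].
by move=> X /= /mem_borel_of[aX _]; apply/soP.
Qed.

Lemma solvable_sub_borel_of U : solvable_subalgebra_so U ->
  exists2 g, orth g & (U <= Ad g @: borel_of F 1)%VS.
Proof.
move=> [sU aU [k solU]].
have soU X : X \in U -> adjm X = - X by move=> /sU/soP.
have [g og gU] := triangularization aU solU soU.
exists (adjm g); first exact: orth_adj.
apply/subvP => X XU; rewrite mem_Ad; last exact: orth_adj.
rewrite adjmK; apply/mem_borel_of; split; last exact: gU.
by rewrite adjm_conj (soU X) // mulmxN mulNmx.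
Qed.

Lemma dim_Ad g U : orth g -> \dim (Ad g @: U) = \dim U.
Proof.
move=> og; have dle h V : (\dim (Ad h @: V) <= \dim V)%N.
  by rewrite -(limg_ker_dim (Ad h) V) leq_addl.
by apply/eqP; rewrite eqn_leq dle -{1}(AdK U og) dle.
Qed.

(** Conjugates of the triangular subalgebra all have the same dimension. A solvable subalgebra above
    one of them lies inside another one, so all three coincide. *)
Lemma flag_variety_soP U : flag_variety_so U <-> exists2 g, orth g & U = (Ad g @: borel_of F 1)%VS.
Proof.
split=> [[sU mU]|[g og ->]].
  have [g og gU] := solvable_sub_borel_of sU; exists g => //.
  by symmetry; apply: mU => //; apply: solvable_subalgebra_Ad borel_of_solvable_subalgebra.
split; first exact: solvable_subalgebra_Ad borel_of_solvable_subalgebra.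
move=> V sV gV; have [h oh hV] := solvable_sub_borel_of sV.
symmetry; apply/eqP; rewrite eqEdim gV (leq_trans (dimvS hV)) //.
by rewrite !dim_Ad.
Qed.

End BorelSubalgebras.

(** * The set of orbits *)

Local Open Scope classical_set_scope.
Local Open Scope card_scope.

Lemma card_le_image_kernel T A B (f : T -> A) (g : T -> B) (D : set T) :
  (forall x y, D x -> D y -> g x = g y -> f x = f y) -> f @` D #<= g @` D.
Proof.
move=> fg; have [->|/set0P[x0 Dx0]] := eqVneq D set0.
  by rewrite !image_set0 card_ge0.
(* The value [f x0] outside the image of [g] is arbitrary. *)
pose h b := if pselect (exists x, D x /\ g x = b) is left P then f (sval (cid P)) else f x0.
apply: card_le_trans (card_image_le h _); apply: subset_card_le.
move=> _ [x Dx <-]; exists (g x); first by exists x.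
rewrite /h; case: pselect => [P|[]]; last by exists x.
by case: (cid P) => y [Dy gy] /=; apply: fg.
Qed.

Lemma card_eq_image_kernel T A B (f : T -> A) (g : T -> B) (D : set T) :
  (forall x y, D x -> D y -> f x = f y <-> g x = g y) -> f @` D #= g @` D.
Proof.
move=> fg; apply/card_eqPle; split; apply: card_le_image_kernel => x y Dx Dy;
  by move=> /(fg x y Dx Dy).
Qed.

Section OrbitSets.
Variables (F : numClosedFieldType) (n : nat).
Implicit Types (x y : 'S_n * {set 'I_n}) (U : {vspace 'M[F]_n}).

Definition admissible_pairs : set ('S_n * {set 'I_n}) := [set x | admissible x.1 x.2].

Definition stratum x : set {vspace 'M[F]_n} :=
  [set U | flag_variety_so U /\ position x.1 x.2 U].

Lemma stratum_eq x y : admissible_pairs x -> admissible_pairs y ->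
  stratum x = stratum y <-> x.2 = y.2 /\ (y.1 = x.1 \/ y.1 = (x.1 * swap n)%g).
Proof.
move=> ax ay; split=> [e|].
  have [g og px] := position_nonempty F ax.
  have : stratum x (Ad g @: borel_of F 1)%VS by split=> //; apply/flag_variety_soP; exists g.
  rewrite e => -[_ py]; exact: position_inj ax ay px py.
case: x y ax ay => p S [q S'] /= [sp _ _] _ [<-{S'} [->//|->]].
by apply/seteqP; split=> U [fU /= /(position_swap _ _ sp)].
Qed.

Lemma orbits_strata (H : set 'M[F]_n) : (forall b, H b <-> stab_vref b) ->
  orbits_flag_variety_so H = stratum @` admissible_pairs.
Proof.
move=> HP.
have orbE U x : flag_variety_so U -> position x.1 x.2 U -> Ad_orbit H U = stratum x.
  move=> fU pU; apply/seteqP; split=> [_ [b /HP sb <-]|V [fV pV]].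
    split; last exact: position_stab.
    have [g og ->] := (flag_variety_soP U).1 fU; apply/flag_variety_soP.
    have [ob _ _] := sb; exists (b *m g); first exact: orthM.
    by rewrite AdM.
  have [b sb ->] := position_trans pU pV; exists b => //; exact/HP.
apply/seteqP; split=> [_ [U fU <-]|_ [x ax <-]].
  have [g og eU] := (flag_variety_soP U).1 fU.
  have [p [S [aS pS]]] := position_exists og; rewrite -eU in pS.
  by exists (p, S) => //; rewrite (orbE U (p, S)).
have [g og px] := position_nonempty F ax.
have fU : flag_variety_so (Ad g @: borel_of F 1)%VS by apply/flag_variety_soP; exists g.
by exists (Ad g @: borel_of F 1)%VS => //; apply: orbE.
Qed.

Lemma stab_vrefP (b : 'M[F]_n) :
  SO_fixing (vref F n) b /\ upper_borel_SO F n b <-> stab_vref b.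
Proof.
have upP : is_trig_mx b^T <-> uptri 1 1 b.
  split=> [/is_trig_mxP h i j|h]; first by rewrite !perm1 => /h; rewrite mxE.
  by apply/is_trig_mxP => i j ij; rewrite mxE h // !perm1.
split=> [[[[/orthP ob _] bv] [_ ub]]|sb]; first by split=> //; apply/upP.
have [ob ub bv] := sb; have db := stab_vref_det sb.
by do 2!split=> //; [split=> //; apply/orthP | split=> //; apply/orthP | apply/upP].
Qed.

End OrbitSets.

Lemma central_odd l (i : 'I_l.*2.+1) : central i = (i == l :> nat).
Proof.
by rewrite /central /lower /=; have := ltn_ord i => hi; apply/andP/eqP; [case|split]; lia.
Qed.

Lemma central_even l (i : 'I_l.*2) : central i = (i == l.-1 :> nat) || (i == l :> nat).
Proof.
rewrite /central /lower /=; have := ltn_ord i => hi.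
by apply/andP/orP => [[? ?]|[/eqP ?|/eqP ?]]; [|split|split]; lia.
Qed.

Lemma vref_odd (F : numFieldType) l : vref F l.*2.+1 = basis_vec F l.*2.+1 l.
Proof.
apply/matrixP => i j; rewrite !mxE central_odd; case: eqP => [e|//].
by rewrite (_ : (i <= _)%N = true) //= e; lia.
Qed.

Lemma vref_even (F : numFieldType) l : (1 <= l)%N ->
  vref F l.*2 = basis_vec F l.*2 l.-1 - basis_vec F l.*2 l.
Proof.
move=> l1; apply/matrixP => i j; rewrite !mxE central_even.
case: (eqVneq (i : nat) l.-1) => [e|ne] /=.
  have -> : (i == l :> nat) = false by rewrite e; lia.
  by rewrite (_ : (i <= _)%N = true) ?subr0 //= e; lia.
case: eqP => [e|_]; last by rewrite subr0.
by rewrite (_ : (i <= _)%N = false) ?sub0r //= e; lia.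
Qed.

Local Close Scope card_scope.
Local Close Scope classical_set_scope.

(** * Admissible pairs and words *)

Section Splitting.
Variables (T : eqType) (x0 : T) (M : pred T).
Implicit Types (w s t : seq T) (ss : seq (seq T)).

(** Cuts [w] after each letter of M; what follows the last such letter is the second component, and
    the branch with empty [r.1] means that no mark lies further right. *)
Fixpoint splitp w : seq (seq T) * seq T :=
  if w is x :: w' then
    let r := splitp w' in
    if M x then ([:: x] :: r.1, r.2)
    else if r.1 is t :: ss then ((x :: t) :: ss, r.2) else ([::], x :: r.2)
  else ([::], [::]).

Lemma splitp_flatten w : flatten (splitp w).1 ++ (splitp w).2 = w.
Proof.
elim: w => //= x w IH; case: ifP => _ /=; first by rewrite IH.
by move: IH; case: (splitp w) => [[|t ss] s] /= ->.
Qed.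

Lemma splitp_neq0 w t : t \in (splitp w).1 -> t != [::].
Proof.
elim: w t => //= x w IH t; case: ifP => _ /=; first by rewrite inE => /orP[/eqP->|/IH].
move: IH; case: (splitp w) => [[|t' ss] s] //= IH.
by rewrite inE => /orP[/eqP->//|tss]; apply: IH; rewrite inE tss orbT.
Qed.

Lemma splitp_last w : map (last x0) (splitp w).1 = filter M w.
Proof.
elim: w => //= x w IH; case: ifP => Mx /=; first by rewrite IH.
have := @splitp_neq0 w; move: IH; case: (splitp w) => [[|t ss] s] //= <- /(_ t).
by rewrite mem_head => /(_ isT); case: t.
Qed.

Lemma splitp_skip x w t ss s : ~~ M x -> splitp w = (t :: ss, s) ->
  splitp (x :: w) = ((x :: t) :: ss, s).
Proof. by move=> /negPf Mx e; rewrite /= Mx e. Qed.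

Lemma splitp_cat t w : t != [::] -> uniq t ->
  (forall x, x \in t -> M x = (x == last x0 t)) ->
  splitp (t ++ w) = (t :: (splitp w).1, (splitp w).2).
Proof.
elim: t => // x [|y t] IH _ /andP[xt ut] hM.
  by rewrite /= hM ?mem_head //= eqxx.
have Mx : ~~ M x.
  by rewrite hM ?mem_head //; apply: contra xt => /eqP ->; rewrite /= mem_last.
have e : splitp ((y :: t) ++ w) = ((y :: t) :: (splitp w).1, (splitp w).2).
  by apply: IH => // z zt; rewrite hM // inE zt orbT.
exact: (splitp_skip Mx e).
Qed.

Lemma splitp_noM s : (forall x, x \in s -> ~~ M x) -> splitp s = ([::], s).
Proof.
elim: s => //= x s IH h; rewrite (negPf (h _ _)) ?mem_head // IH // => y ys.
by apply: h; rewrite inE ys orbT.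
Qed.

Lemma splitp_concat ss s : uniq (flatten ss) ->
  (forall t, t \in ss -> t != [::]) ->
  (forall t x, t \in ss -> x \in t -> M x = (x == last x0 t)) ->
  (forall x, x \in s -> ~~ M x) ->
  splitp (flatten ss ++ s) = (ss, s).
Proof.
elim: ss => [|t ss IH] /=; first by move=> _ _ _; apply: splitp_noM.
rewrite cat_uniq => /and3P[ut _ uss] h0 hM hs.
rewrite -catA splitp_cat ?h0 ?mem_head // ?IH // => [t' t's|t' x t's|x xt].
- by apply: h0; rewrite inE t's orbT.
- by apply: hM; rewrite inE t's orbT.
- by apply: hM => //; rewrite mem_head.
Qed.

Lemma index_last_flatten ss s t x : uniq (flatten ss ++ s) -> t \in ss -> x \in t ->
  (index x (flatten ss ++ s) <= index (last x0 t) (flatten ss ++ s))%N.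
Proof.
elim: ss => [//|t' ss IH] /= u; rewrite inE => /orP[/eqP->|tss] xt.
  have lt : last x0 t' \in t' by case: (t') xt => // a b _; rewrite /= mem_last.
  rewrite -catA !index_cat xt lt.
  have u' : uniq t' by move: u; rewrite -catA cat_uniq => /and3P[].
  move: u' xt {lt u}; case/lastP: t' => [//|r y] u xy.
  rewrite last_rcons -[X in (_ <= X)%N](_ : size r = _); last first.
    by rewrite -cats1 index_cat /= eqxx addn0; move: u; rewrite rcons_uniq => /andP[/negPf->].
  by rewrite -ltnS -(size_rcons r y) index_mem.
move: u; rewrite -catA cat_uniq => /and3P[_ /hasPn nt u].
have xf : x \in flatten ss by apply/flattenP; exists t.
have lt : last x0 t \in flatten ss.
  by apply/flattenP; exists t => //; case: (t) xt => // a b _; rewrite /= mem_last.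
rewrite ![index _ (t' ++ _)]index_cat (negPf (nt x _)) ?mem_cat ?xf //.
rewrite (negPf (nt (last x0 t) _)) ?mem_cat ?lt //.
by rewrite leq_add2l; apply: IH.
Qed.

End Splitting.

(** * The word of an admissible pair *)

Section Words.
Variables (n : nat) (x0 : 'I_n).
Implicit Types (p q : 'S_n) (i j k c : 'I_n) (S : {set 'I_n}).

Definition nonneg i := (i <= rev_ord i)%N.
Definition absI i := if nonneg i then i else rev_ord i.
Definition halfpos : seq 'I_n := [seq i <- enum 'I_n | nonneg i].

Lemma nonneg_half i : nonneg i = (i < uphalf n)%N.
Proof. by rewrite /nonneg /=; have := ltn_ord i; lia. Qed.

Lemma mem_halfpos i : (i \in halfpos) = nonneg i.
Proof. by rewrite mem_filter mem_enum andbT. Qed.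

Lemma val_halfpos : map val halfpos = iota 0 (uphalf n).
Proof.
rewrite /halfpos (eq_filter nonneg_half).
transitivity [seq k <- map val (enum 'I_n) | (k < uphalf n)%N].
  by rewrite filter_map.
rewrite val_enum_ord.
by apply: (@filter_iota_ltn 0); lia.
Qed.

Lemma size_halfpos : size halfpos = uphalf n.
Proof. by rewrite -(size_map val) val_halfpos size_iota. Qed.

Lemma nth_halfpos (m : nat) : (m < uphalf n)%N -> nth x0 halfpos m = m :> nat.
Proof.
move=> hk; rewrite -(nth_map x0 (val x0)) ?size_halfpos // val_halfpos.
by rewrite nth_iota.
Qed.

Lemma nth_halfpos_ord k : nonneg k -> nth x0 halfpos k = k.
Proof. by rewrite nonneg_half => hk; apply: val_inj; rewrite /= nth_halfpos. Qed.

Lemma uniq_halfpos : uniq halfpos.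
Proof. by rewrite filter_uniq // enum_uniq. Qed.

Lemma absI_nonneg i : nonneg (absI i).
Proof.
rewrite /absI; case: ifP => //; rewrite /nonneg rev_ordK.
by move/negbT; rewrite -ltnNge => /ltnW.
Qed.

Lemma absI_id i : nonneg i -> absI i = i.
Proof. by rewrite /absI => ->. Qed.

Lemma absI_or i : absI i = i \/ absI i = rev_ord i.
Proof. by rewrite /absI; case: ifP; [left|right]. Qed.

Lemma nonneg_self i : nonneg i -> nonneg (rev_ord i) -> rev_ord i = i.
Proof.
rewrite /nonneg rev_ordK => a b; apply/val_inj/eqP; by rewrite eqn_leq a b.
Qed.

Lemma nonneg_rev i : ~~ nonneg i -> nonneg (rev_ord i).
Proof. by rewrite /nonneg rev_ordK -ltnNge => /ltnW. Qed.

Lemma absI_rev i : absI (rev_ord i) = absI i.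
Proof.
rewrite /absI rev_ordK; case a: (nonneg i); case b: (nonneg (rev_ord i)) => //.
  exact: nonneg_self.
by have := nonneg_rev (negbT a); rewrite b.
Qed.

Lemma absI_eq i j : absI i = absI j -> j = i \/ j = rev_ord i.
Proof.
case: (absI_or i) => ->; case: (absI_or j) => -> e.
- by left. - by right; rewrite e rev_ordK. - by right. - by left; apply: rev_ord_inj.
Qed.

Lemma lower_nonneg i : lower i -> nonneg i.
Proof. by move=> /lower_lt/ltnW. Qed.

Lemma nonneg_lower i : nonneg i -> ~~ central i -> lower i.
Proof.
rewrite /nonneg /central /lower rev_ordK negb_and !negbK => a /orP[//|b].
by lia.
Qed.

Lemma central_absI i : central (absI i) = central i.
Proof. by case: (absI_or i) => ->; rewrite ?central_rev. Qed.

Lemma central_mid : exists c : 'I_n, central c.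
Proof.
have hk : (n./2 < n)%N by have := ltn_ord x0; lia.
by exists (Ordinal hk); rewrite /central /lower /=; lia.
Qed.

(* The k-th letter of the word of (p, S) is the k-th basis vector of the flag;
   a letter rev i with i in S is flipped to i and closes a list, and the sign
   of the central letter, which the flag does not determine, is forgotten. *)
Definition letter_at p S k :=
  let i := (p^-1)%g k in
  if rev_ord i \in S then rev_ord i else if central k then absI i else i.

Definition word p S := [seq letter_at p S k | k <- halfpos].

Lemma rev_symV p : rev_sym p -> forall k, (p^-1)%g (rev_ord k) = rev_ord ((p^-1)%g k).
Proof. by move=> sp k; apply: (@perm_inj _ p); rewrite permKV rev_symE ?permKV. Qed.

(** i precedes a central c and its dual, whose ranks are dual, so the rank of i exceeds both and
    lies strictly beyond the middle. Hence e_(-i) occurs in the first half of the flag. *)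
Lemma admissible_upper p S i : admissible p S -> i \in S -> lower (rev_ord (p i)).
Proof.
move=> [sp lS aS] iS; have [c cc] := central_mid; have li := lS _ iS.
have lt k : central k -> (p k < p i)%N.
  move=> ck; apply: aS => //; first by rewrite ck orbT.
  by have /andP[] := lower_central_lt li ck.
have a := lt c cc; have := lt (rev_ord c); rewrite central_rev => /(_ cc).
rewrite rev_symE // /lower rev_ordK /= => b.
by have := ltn_ord (p i); have := ltn_ord (p c); lia.
Qed.

Lemma absI_letter_at p S k : absI (letter_at p S k) = absI ((p^-1)%g k).
Proof.
rewrite /letter_at; case: ifP => _; first by rewrite absI_rev.
by case: ifP => _ //; rewrite (absI_id (absI_nonneg _)).
Qed.

Lemma letter_at_inj p S k k' : rev_sym p -> nonneg k -> nonneg k' ->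
  absI (letter_at p S k) = absI (letter_at p S k') -> k = k'.
Proof.
move=> sp hk hk'; rewrite !absI_letter_at => /absI_eq[/perm_inj->//|].
rewrite -rev_symV // => /perm_inj e; rewrite e in hk' *.
by rewrite nonneg_self.
Qed.

Lemma word_perm p S : rev_sym p -> perm_eq (map absI (word p S)) halfpos.
Proof.
move=> sp.
have u : uniq (map absI (word p S)).
  rewrite -map_comp map_inj_in_uniq ?uniq_halfpos // => k k'.
  by rewrite !mem_halfpos => hk hk' /(letter_at_inj sp hk hk').
have sub : {subset map absI (word p S) <= halfpos}.
  by move=> _ /mapP[i _ ->]; rewrite mem_halfpos absI_nonneg.
apply: uniq_perm => //; first exact: uniq_halfpos.
by apply: (uniq_min_size u sub _).2; rewrite !size_map.
Qed.

Lemma uniq_word p S : rev_sym p -> uniq (word p S).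
Proof.
move=> sp; apply: (map_uniq (f := absI)).
by rewrite (perm_uniq (word_perm S sp)) uniq_halfpos.
Qed.

Lemma index_word p S k : rev_sym p -> nonneg k -> index (letter_at p S k) (word p S) = k.
Proof.
move=> sp hk; have hk' : (k < size halfpos)%N by rewrite size_halfpos -nonneg_half.
rewrite -[in letter_at _ _ _](nth_halfpos_ord hk) -(nth_map x0 x0) // index_uniq ?size_map //.
exact: uniq_word.
Qed.

Lemma mem_word p S x : x \in word p S -> exists2 k, nonneg k & x = letter_at p S k.
Proof. by move=> /mapP[k]; rewrite mem_halfpos; exists k. Qed.

Lemma letter_at_mark p S i : admissible p S -> i \in S -> letter_at p S (p (rev_ord i)) = i.
Proof. by move=> _ iS; rewrite /letter_at permK rev_ordK iS. Qed.

Lemma mark_nonneg p S i : admissible p S -> i \in S -> lower (p (rev_ord i)).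
Proof. by move=> aS iS; have [sp _ _] := aS; rewrite rev_symE //; apply: admissible_upper aS iS. Qed.

Lemma mem_word_mark p S i : admissible p S -> i \in S -> i \in word p S.
Proof.
move=> aS iS; rewrite -{1}(letter_at_mark aS iS); apply: map_f.
by rewrite mem_halfpos lower_nonneg // (mark_nonneg aS).
Qed.

Lemma index_mark p S i : admissible p S -> i \in S -> index i (word p S) = p (rev_ord i).
Proof.
move=> aS iS; have [sp _ _] := aS.
by rewrite -{1}(letter_at_mark aS iS) index_word // lower_nonneg // (mark_nonneg aS).
Qed.

Lemma last_word p S : rev_sym p ->
  exists2 k, central k && nonneg k & last x0 (word p S) = letter_at p S k.
Proof.
move=> sp; have n0 : (0 < n)%N by apply: leq_ltn_trans (ltn_ord x0).
have hh : ((uphalf n).-1 < uphalf n)%N by lia.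
pose k := nth x0 halfpos (uphalf n).-1.
have kE : k = (uphalf n).-1 :> nat by apply: nth_halfpos.
exists k; last by rewrite -nth_last size_map size_halfpos (nth_map x0) ?size_halfpos.
rewrite nonneg_half /central /lower rev_ordK /= kE hh andbT.
by apply/andP; split; lia.
Qed.

Lemma central_nonneg_last k k' : central k -> nonneg k -> central k' -> nonneg k' -> k = k'.
Proof.
move=> ck hk ck' hk'; case: (central_eq ck ck') => // e; rewrite e in hk' *.
by rewrite nonneg_self.
Qed.

(** A signed partition into lists, written with positions in a canonical order: [s] is the list with
    the central letter, and the others are sorted by their last letters. The clause on self-dual
    letters concerns only e_0 in odd dimension. *)
Definition valid (ss : seq (seq 'I_n)) (s : seq 'I_n) :=
  [/\ perm_eq (map absI (flatten ss ++ s)) halfpos,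
      forall t, t \in ss -> t != [::] /\ nonneg (last x0 t),
      nonneg (last x0 s),
      sorted (fun i j => i < j)%N (map (last x0) ss)
    & has (@central n) s /\ forall i, i \in s -> rev_ord i = i -> last x0 s = i].

Lemma splitp_valid p S : admissible p S ->
  valid (splitp (mem S) (word p S)).1 (splitp (mem S) (word p S)).2.
Proof.
move=> aS; have [sp lS mS] := aS.
set w := word p S; set ss := (splitp _ _).1; set s := (splitp _ _).2.
have wE : flatten ss ++ s = w by apply: splitp_flatten.
have uw : uniq w := uniq_word S sp.
have lE : map (last x0) ss = filter (mem S) w by apply: splitp_last.
have lS' t : t \in ss -> last x0 t \in S.
  by move=> tss; have := map_f (last x0) tss; rewrite lE mem_filter => /andP[].
(* A central letter at or before a mark i would give the dual of that central vector a rank not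
   below that of i, against admissibility. *)
have central_s x : x \in w -> central x -> x \in s.
  rewrite -{1}wE mem_cat => /orP[/flattenP[t tss xt] cx|//].
  have := @index_last_flatten _ x0 ss s t x; rewrite wE => /(_ uw tss xt).
  have iS := lS' t tss; rewrite (index_mark aS iS).
  have xw : x \in w by rewrite -wE mem_cat; apply/orP; left; apply/flattenP; exists t.
  have [k hk xk] := mem_word xw; rewrite xk index_word //.
  have ck : central ((p^-1)%g k) by rewrite -central_absI -(absI_letter_at p S) -xk central_absI.
  have := mS (last x0 t) (rev_ord ((p^-1)%g k)) iS.
  rewrite central_rev ck orbT => /(_ isT).
  have /andP[-> _] := lower_central_lt (lS _ iS) (etrans (central_rev _) ck).
  move=> /(_ isT); rewrite rev_symE // permKV rev_symE // /=.
  by have := ltn_ord k; have := ltn_ord (p (last x0 t)); lia.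
have [K /andP[cK hK] lw] := last_word S sp.
have ls0 : s != [::] -> last x0 s = last x0 w.
  by case: (s) wE => // a r <- _; rewrite last_cat.
have [c0 cc0] := central_mid.
have [x xw cx] : exists2 x, x \in w & central x.
  have : absI c0 \in map absI w.
    by rewrite (perm_mem (word_perm S sp)) mem_halfpos absI_nonneg.
  by move=> /mapP[x xw e]; exists x; rewrite // -central_absI -e central_absI.
have s0 : s != [::] by have := central_s x xw cx; case: (s).
split.
- by rewrite wE; apply: word_perm.
- move=> t tss; split; first exact: splitp_neq0 tss.
  by apply/lower_nonneg/lS/lS'.
- rewrite ls0 // lw /letter_at; case: ifP => [/lS/lower_nonneg//|_].
  by rewrite cK absI_nonneg.
(* A mark i stands at the rank of its dual. Admissibility makes p decrease along S, so the marks
   increase along the word. *)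
- rewrite lE; pose r i j := (index i w < index j w)%N.
  have rt : transitive r by move=> j i k; apply: ltn_trans.
  have rw : sorted r w.
    rewrite /w /word sorted_map.
    have : sorted (relpre val ltn) halfpos by rewrite -sorted_map val_halfpos iota_ltn_sorted.
    apply: (sub_in_sorted (P := [pred k | nonneg k])); last first.
      by apply/allP => k; rewrite mem_halfpos.
    by move=> k k' /= hk hk' kk'; rewrite /r !index_word.
  apply: (sub_in_sorted (P := mem S) (e := r)); last exact: sorted_filter.
    move=> i k iS kS; rewrite /r !(index_mark aS) // => ik.
    rewrite ltnNge leq_eqVlt; apply/negP => /orP[/eqP/val_inj e|ki].
      by rewrite e ltnn in ik.
    have := mS k i kS; rewrite iS => /(_ isT ki); move: ik; rewrite !rev_symE //=.
    by have := ltn_ord (p i); have := ltn_ord (p k); lia.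
  exact: filter_all.
- split; first by apply/hasP; exists x => //; apply: central_s.
  move=> i is_ ri; have iw : i \in w by rewrite -wE mem_cat is_ orbT.
  have [k hk ik] := mem_word iw; rewrite ls0 // lw ik; congr letter_at.
  have ki : (p^-1)%g k = i.
    have : absI i = absI ((p^-1)%g k) by rewrite {1}ik absI_letter_at.
    by move=> /absI_eq[->|->]; rewrite ?ri.
  apply: central_nonneg_last => //.
  have : rev_ord k = k by rewrite -(permKV p k) -rev_symE // ki ri.
  by move=> e; rewrite /central e andbb /lower e -leqNgt ltnW.
Qed.

(** No element of S lies in the first half of the flag, so a letter in S must be a flipped one, and
    [p] can be read off everywhere except for the sign at the central rank. *)
Lemma word_eq p p' S : admissible p S -> admissible p' S -> word p S = word p' S ->
  p' = p \/ p' = (p * swap n)%g.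
Proof.
move=> aS aS' ew; have [sp lS mS] := aS; have [sp' _ mS'] := aS'.
have ewd k : nonneg k -> letter_at p S k = letter_at p' S k.
  move=> hk; have := congr1 (fun w => nth x0 w k) ew.
  by rewrite !(nth_map x0) ?size_halfpos -?nonneg_half ?nth_halfpos_ord.
have nS q k : admissible q S -> nonneg k -> (q^-1)%g k \notin S.
  move=> aq hk; apply/negP => /(admissible_upper aq); rewrite permKV => l.
  by have := lower_lt l; rewrite rev_ordK ltnNge => /negP; apply.
have half k : nonneg k -> ~~ central k -> (p'^-1)%g k = (p^-1)%g k.
  move=> hk /negPf ck; have := ewd k hk; rewrite /letter_at ck.
  have := nS p k aS hk; have := nS p' k aS' hk.
  case: ifP => a; case: ifP => b // c d e.
  - by apply/rev_ord_inj/esym.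
  - by rewrite -e a in c.
  - by rewrite e b in d.
have nc k : ~~ central k -> (p'^-1)%g k = (p^-1)%g k.
  move=> ck; have [hk|hk] := boolP (nonneg k); first exact: half.
  apply: rev_ord_inj; rewrite -!rev_symV //; apply: half; first exact: nonneg_rev.
  by rewrite central_rev.
have [c cc] := central_mid; pose K := absI c.
have cK : central K by rewrite central_absI.
have : absI ((p^-1)%g K) = absI ((p'^-1)%g K).
  by rewrite -!(absI_letter_at _ S) ewd // absI_nonneg.
have pE (q r : 'S_n) : (forall k, (q^-1)%g k = (r^-1)%g k) -> q = r.
  by move=> h; apply: invg_inj; apply/permP.
move=> /absI_eq[e|e]; [left|right].
  apply: pE => k; have [ck|/nc//] := boolP (central k).
  by case: (central_eq cK ck) => ->; rewrite ?rev_symV // e.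
apply: pE => k; rewrite invgM permM swapV swapE.
have [ck|/nc//] := boolP (central k).
by case: (central_eq cK ck) => ->; rewrite ?rev_symV // e ?rev_ordK.
Qed.

Lemma word_swap p S : admissible p S -> word (p * swap n) S = word p S.
Proof.
move=> aS; have [sp lS _] := aS; apply/eq_in_map => k; rewrite mem_halfpos => hk.
rewrite /letter_at invgM permM swapV swapE; case ck: (central k) => //.
rewrite rev_symV // rev_ordK absI_rev; set i := (p^-1)%g k.
have pi : p i = k by rewrite permKV.
move: (ck); rewrite /central => /andP[/negPf lk /negPf lrk].
case: ifP => [/(admissible_upper aS)|_]; first by rewrite pi lrk.
by case: ifP => [/(admissible_upper aS)|//]; rewrite rev_symE // pi rev_ordK lk.
Qed.

Lemma splitp_word_inj p p' S S' : admissible p S -> admissible p' S' ->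
  splitp (mem S) (word p S) = splitp (mem S') (word p' S') ->
  S = S' /\ (p' = p \/ p' = (p * swap n)%g).
Proof.
move=> aS aS' e.
have ew : word p S = word p' S'.
  by rewrite -(splitp_flatten (mem S) (word p S)) e splitp_flatten.
have eS : S = S'.
  have lE := splitp_last x0 (mem S) (word p S).
  have lE' := splitp_last x0 (mem S') (word p' S').
  rewrite e lE' -ew in lE.
  apply/setP => i; apply/idP/idP => iS.
    have : i \in filter (mem S) (word p S) by rewrite mem_filter [mem S i]iS (mem_word_mark aS).
    by rewrite -lE mem_filter => /andP[].
  have : i \in filter (mem S') (word p S) by rewrite mem_filter [mem S' i]iS ew (mem_word_mark aS').
  by rewrite lE mem_filter => /andP[].
by split=> //; rewrite -eS in aS' ew *; apply: (word_eq aS aS' ew).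
Qed.

End Words.

Section SeqFacts.
Variable T : eqType.
Implicit Types (s t w : seq T) (ss : seq (seq T)).

Lemma sorted_index w : uniq w -> sorted (fun x y => index x w < index y w)%N w.
Proof.
case: w => // x0 w u; apply/(sortedP x0) => i hi.
by rewrite !index_uniq // ltnW.
Qed.

Lemma subseq_last (x0 : T) ss : (forall t, t \in ss -> t != [::]) ->
  subseq (map (last x0) ss) (flatten ss).
Proof.
elim: ss => //= t ss IH h; rewrite -cat1s; apply: cat_subseq.
  by rewrite sub1seq; have := h t (mem_head _ _); case: (t) => //= a b _; apply: mem_last.
by apply: IH => t' t's; apply: h; rewrite inE t's orbT.
Qed.

Lemma uniq_flatten_eq ss t t' x : uniq (flatten ss) -> t \in ss -> t' \in ss ->
  x \in t -> x \in t' -> t = t'.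
Proof.
elim: ss => //= a ss IH; rewrite cat_uniq => /and3P[_ /hasPn h u].
rewrite !inE => /orP[/eqP->|ts] /orP[/eqP->|t's] // xt xt'.
- have : x \in flatten ss by apply/flattenP; exists t'.
  by move=> /h; rewrite /= xt.
- have : x \in flatten ss by apply/flattenP; exists t.
  by move=> /h; rewrite /= xt'.
- exact: IH.
Qed.

Lemma uniq_map_inj (T' : eqType) (f : T -> T') w : uniq (map f w) -> {in w &, injective f}.
Proof.
elim: w => //= a w IH /andP[fa u] x y; rewrite !inE => /orP[/eqP->|xw] /orP[/eqP->|yw] // e.
- by move: fa; rewrite e map_f.
- by move: fa; rewrite -e map_f.
- exact: IH.
Qed.

End SeqFacts.

(** * From a canonical list of lists back to an admissible pair *)

Section Realization.
Variables (n : nat) (x0 : 'I_n) (ss : seq (seq 'I_n)) (s : seq 'I_n).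
Hypothesis vs : valid x0 ss s.
Let w := flatten ss ++ s.
Implicit Types (i j k c : 'I_n).

Let pw : perm_eq (map (@absI n) w) (halfpos n). Proof. by case: vs. Qed.

Let uaw : uniq (map (@absI n) w). Proof. by rewrite (perm_uniq pw) uniq_halfpos. Qed.

Let uw : uniq w. Proof. exact: map_uniq uaw. Qed.

Let size_w : size w = uphalf n.
Proof. by rewrite -(size_map (@absI n)) (perm_size pw) size_halfpos. Qed.

Let ss0 t : t \in ss -> t != [::]. Proof. by case: vs => _ h _ _ _ /h[]. Qed.

Let last_in t : t \in ss -> last x0 t \in t.
Proof. by move=> /ss0; case: t => // a b _; rewrite /= mem_last. Qed.

Definition marks : {set 'I_n} := [set i in map (last x0) ss].

Let mem_flat t i : t \in ss -> i \in t -> i \in flatten ss.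
Proof. by move=> tss it; apply/flattenP; exists t. Qed.

Let flat_w i : i \in flatten ss -> i \in w. Proof. by rewrite mem_cat => ->. Qed.

Let flat_s i : i \in flatten ss -> i \notin s.
Proof.
by move: uw; rewrite cat_uniq => /and3P[_ /hasPn h _] iss; apply/negP => /h; rewrite /= iss.
Qed.

Let flat_central i : i \in flatten ss -> ~~ central i.
Proof.
move=> iss; have [_ _ _ _ [/hasP[c cs cc] _]] := vs; apply/negP => ci.
have e : absI c = absI i by case: (central_eq cc ci) => ->; rewrite ?absI_rev.
have ic : c = i by apply: (uniq_map_inj uaw _ _ e); [rewrite mem_cat cs orbT | exact: flat_w].
by have := flat_s iss; rewrite -ic cs.
Qed.

Let marksP i : i \in marks -> lower i /\ i \in flatten ss.
Proof.
rewrite inE => /mapP[t tss ->]; have [_ h _ _ _] := vs; have [_ nn] := h t tss.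
have f := mem_flat tss (last_in tss); split=> //.
by apply: nonneg_lower => //; apply: flat_central.
Qed.

Let central_marks i : central i -> i \notin marks.
Proof. by move=> ci; apply/negP => /marksP[/lower_central]; rewrite ci. Qed.

(** Undoes the flips of [letter_at]: the closing letter of a list in [ss] stands for its dual
    position. *)
Let q0 k := let x := nth x0 w k in if x \in marks then rev_ord x else x.

Definition qf k := if nonneg k then q0 k else rev_ord (q0 (rev_ord k)).

Let absI_q0 k : absI (q0 k) = absI (nth x0 w k).
Proof. by rewrite /q0; case: ifP; rewrite ?absI_rev. Qed.

Let nth_w k : nonneg k -> nth x0 w k \in w.
Proof. by rewrite nonneg_half => hk; rewrite mem_nth // size_w. Qed.

Let self_central i : rev_ord i = i -> central i.
Proof. by move=> e; rewrite /central e andbb /lower e -leqNgt ltnW. Qed.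

Let self_last i : i \in w -> rev_ord i = i -> nth x0 w (uphalf n).-1 = i.
Proof.
move=> iw ri; have is_ : i \in s.
  by move: iw; rewrite mem_cat => /orP[/flat_central|//]; rewrite self_central.
have [_ _ _ _ [_ h]] := vs; rewrite -size_w nth_last /w last_cat -(h i) //.
by case: (s) is_.
Qed.

(** The two halves of [qf] overlap at the self-dual rank, present in odd dimension only. A self-dual
    letter can occur only at the end of [w], which is that rank; this makes [qf] consistent and
    injective. *)
Let q0_self k : nonneg k -> (rev_ord (q0 k) == q0 k) = (rev_ord k == k).
Proof.
move=> hk; have hk' := hk; rewrite nonneg_half in hk'.
apply/eqP/eqP => e.
  have rx : rev_ord (nth x0 w k) = nth x0 w k.
    by move: e; rewrite /q0; case: ifP => // _ /rev_ord_inj.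
  have := self_last (nth_w hk) rx => /eqP; rewrite nth_uniq ?size_w //; last by lia.
  move=> /eqP kE; have := congr1 val rx; rewrite /= => e1.
  apply: val_inj => /=; have := ltn_ord (nth x0 w k); have := ltn_ord k; lia.
have [_ _ _ _ [/hasP[c cs cc] h]] := vs.
have rc : rev_ord c = c.
  apply: val_inj; move: cc; rewrite /central /lower rev_ordK /=.
  have := congr1 val e; have := ltn_ord c; have := ltn_ord k; rewrite /=; lia.
have cw : c \in w by rewrite mem_cat cs orbT.
have kE : (uphalf n).-1 = k by have := congr1 val e; have := ltn_ord k; rewrite /=; lia.
have := self_last cw rc; rewrite kE /q0 => ->.
by rewrite (negPf (central_marks cc)).
Qed.

Let absI_inj_nth k k' : nonneg k -> nonneg k' ->
  absI (nth x0 w k) = absI (nth x0 w k') -> k = k'.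
Proof.
move=> hk hk' e; apply/val_inj/eqP.
rewrite -(nth_uniq x0 _ _ uw) ?size_w -?nonneg_half //; apply/eqP.
by apply: (uniq_map_inj uaw) => //; apply: nth_w.
Qed.

Lemma qf_rev k : qf (rev_ord k) = rev_ord (qf k).
Proof.
rewrite /qf rev_ordK; case a: (nonneg k); case b: (nonneg (rev_ord k)) => //.
- have e := nonneg_self a b; rewrite e; apply/esym/eqP.
  by rewrite q0_self // e.
- by rewrite rev_ordK.
- by have := nonneg_rev (negbT a); rewrite b.
Qed.

Lemma qf_inj : injective qf.
Proof.
have key k k' : nonneg k -> nonneg k' -> qf k = qf k' -> k = k'.
  move=> hk hk'; rewrite /qf hk hk' => /(congr1 (@absI n)); rewrite !absI_q0.
  exact: absI_inj_nth.
have key2 k k' : nonneg k -> ~~ nonneg k' -> qf k = qf k' -> k = k'.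
  move=> hk hk' e; have hr := nonneg_rev hk'.
  have kr : k = rev_ord k'.
    apply: absI_inj_nth => //; rewrite -!absI_q0.
    by move: (congr1 (@absI n) e); rewrite /qf hk (negPf hk') absI_rev.
  have : rev_ord (q0 k) == q0 k.
    by apply/eqP; move: e; rewrite /qf hk (negPf hk') -kr => {2}->.
  by rewrite q0_self // kr rev_ordK => /eqP.
move=> k k' e; have [hk|hk] := boolP (nonneg k); have [hk'|hk'] := boolP (nonneg k').
- exact: key.
- exact: key2.
- by apply/esym/key2.
- apply: rev_ord_inj; apply: key; [exact: nonneg_rev|exact: nonneg_rev|].
  by rewrite !qf_rev e.
Qed.

Definition rank : 'S_n := ((perm qf_inj)^-1)%g.

Let rankV k : (rank^-1)%g k = qf k. Proof. by rewrite invgK permE. Qed.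

Lemma rev_sym_rank : rev_sym rank.
Proof.
apply/permP => i; rewrite rev_conjE; apply: (@perm_inj _ (rank^-1)%g).
by rewrite permK rankV qf_rev -rankV permK rev_ordK.
Qed.

Let rank_w i : i \in w -> rank (if i \in marks then rev_ord i else i) = index i w :> nat.
Proof.
move=> iw; have hk : (index i w < n)%N.
  by rewrite (leq_trans (n := size w)) ?index_mem // size_w; have := ltn_ord i; lia.
pose k := Ordinal hk.
have nk : nonneg k by rewrite nonneg_half /= -size_w index_mem.
have -> : (if i \in marks then rev_ord i else i) = qf k by rewrite /qf nk /q0 /= nth_index.
by rewrite -rankV permKV.
Qed.

Let rank_mark i : i \in marks -> rank (rev_ord i) = index i w :> nat.
Proof. by move=> im; have [_ /flat_w/rank_w] := marksP im; rewrite im. Qed.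

Let index_marks i k : i \in marks -> k \in marks -> (i < k)%N -> (index i w < index k w)%N.
Proof.
rewrite !inE => im km ik; have [_ _ _ so _] := vs.
have sr : sorted (fun x y => index x w < index y w)%N (map (last x0) ss).
  apply: subseq_sorted (sorted_index uw); first by move=> y x z; apply: ltn_trans.
  apply: subseq_trans (subseq_last _ ss0) _; exact: prefix_subseq.
apply: (sorted_ltn_index _ sr) => //; first by move=> y x z; apply: ltn_trans.
have tr : transitive (fun i j : 'I_n => i < j)%N by move=> y x z; apply: ltn_trans.
rewrite ltnNge leq_eqVlt; apply/negP => /orP[/eqP e|lt].
  by move: ik; rewrite -(nth_index x0 im) -(nth_index x0 km) e ltnn.
by have := sorted_ltn_index tr so _ _ km im lt; move/(ltn_trans ik); rewrite ltnn.
Qed.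

Lemma admissible_rank : admissible rank marks.
Proof.
split; [exact: rev_sym_rank|by move=> i /marksP[]|] => i k im hk ik.
have rr j : rank (rev_ord j) = (n - (rank j).+1)%N :> nat by rewrite rev_symE //; exact: rev_sym_rank.
have := rank_mark im; rewrite rr => ei; have := ltn_ord (rank i); have := ltn_ord (rank k).
case/orP: hk => [km|ck].
  by have := index_marks im km ik; have := rank_mark km; rewrite rr; lia.
have [_ _ _ _ [/hasP[c cs cc] _]] := vs.
have cw : c \in w by rewrite mem_cat cs orbT.
have := rank_w cw; rewrite (negPf (central_marks cc)) => ec.
have [_ fi] := marksP im.
have lt : (index i w < index c w)%N.
  rewrite /w !index_cat fi ifN; last by apply/negP => /flat_s; rewrite cs.
  by rewrite (leq_trans (n := size (flatten ss))) ?index_mem ?leq_addr.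
have hc : (rank c < uphalf n)%N by rewrite ec -size_w index_mem.
case: (central_eq cc ck) => ->; rewrite ?rr; lia.
Qed.

Lemma word_rank : word rank marks = w.
Proof.
apply: (@eq_from_nth _ x0); first by rewrite size_map size_halfpos size_w.
rewrite size_map size_halfpos => m hm.
have hmn : (m < n)%N by apply: leq_trans hm _; have := ltn_ord x0; lia.
pose k := Ordinal hmn; have nk : nonneg k by rewrite nonneg_half.
rewrite (nth_map x0) ?size_halfpos // -[m]/(val k) nth_halfpos_ord // /letter_at rankV /qf nk /q0.
set x := nth x0 w k; have xw : x \in w by apply: nth_w.
have [xm|xm] := boolP (x \in marks); first by rewrite rev_ordK xm.
(* If the dual of the unmarked letter x were a mark, both would be letters of [w] with the same
   absolute value; then x is self-dual, hence central, whereas marks are not. *)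
rewrite ifN; last first.
  apply/negP => rm; have [l f] := marksP rm.
  have e : rev_ord x = x := uniq_map_inj uaw (flat_w f) xw (absI_rev x).
  by move: l; rewrite e => /lower_central; rewrite self_central.
(* The central rank of the first half carries the last letter of [s], which is non-negative, so
   forgetting its sign changes nothing. *)
case: ifP => // ck; apply: absI_id.
have [_ _ nl _ [/hasP[c cs _] _]] := vs.
have -> : x = last x0 s.
  have -> : last x0 s = last x0 w by rewrite /w last_cat; case: (s) cs.
  rewrite -nth_last size_w /x; congr nth.
  by move: ck nk; rewrite /central /lower rev_ordK nonneg_half /=; lia.
by [].
Qed.

Lemma splitp_rank : splitp (mem marks) (word rank marks) = (ss, s).
Proof.
rewrite word_rank; have := uw; rewrite cat_uniq => /and3P[uf _ _].
apply: (@splitp_concat _ x0) => // [t x tss xt|x xs].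
  apply/idP/eqP => [|->]; last by rewrite /= inE map_f.
  rewrite /= inE => /mapP[t' t's e]; rewrite e; congr last.
  by apply: (uniq_flatten_eq uf t's tss _ xt); rewrite e last_in.
by apply/negP => /marksP[_ /flat_s]; rewrite xs.
Qed.

End Realization.

(** * Signed partitions into lists *)

Section UniqFlatten.
Variables (T T' : eqType) (f : T -> T').

Lemma uniq_map_flatten (ls : seq (seq T)) : uniq ls ->
  (forall t, t \in ls -> uniq (map f t)) ->
  (forall t u x y, t \in ls -> u \in ls -> x \in t -> y \in u -> f x = f y -> t = u) ->
  uniq (map f (flatten ls)).
Proof.
elim: ls => //= t ls IH /andP[tls u] ut dis.
rewrite map_cat cat_uniq ut ?mem_head //= IH //; last first.
- by move=> a b x y als bls; apply: dis; rewrite inE ?als ?bls orbT.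
- by move=> a als; apply: ut; rewrite inE als orbT.
rewrite andbT; apply/hasPn => _ /mapP[y /flattenP[b bls yb] ->].
apply/negP => /mapP[x xt e]; move: tls.
have -> : t = b by apply: (dis t b x y); rewrite ?mem_head // inE bls orbT.
by rewrite bls.
Qed.

End UniqFlatten.

Section Letters.
Variable n : nat.
Implicit Types (i j : 'I_n).

(* The position of e_j is sent to j. *)
Definition letter i : int :=
  if rev_ord i == i then 0 else if nonneg i then i.+1%:Z else - (rev_ord i).+1%:Z.

Lemma letter_rev i : letter (rev_ord i) = - letter i.
Proof.
rewrite /letter rev_ordK eq_sym; case: eqP => [_|/eqP ne]; first by rewrite oppr0.
case a: (nonneg i); case b: (nonneg (rev_ord i)) => //.
- by rewrite (nonneg_self a b) eqxx in ne.
- by have := nonneg_rev (negbT a); rewrite b.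
Qed.

Lemma letter_absI i : `|letter i|%N = if rev_ord i == i then 0%N else (absI i).+1.
Proof.
rewrite /letter; case: eqP => // _; rewrite /absI; case: ifP => // _.
Qed.

Lemma letter_eq0 i : (letter i == 0) = (rev_ord i == i).
Proof. by rewrite -absz_eq0 letter_absI; case: (rev_ord i =P i). Qed.

Lemma letter_ge0 i : (0 <= letter i) = nonneg i.
Proof.
rewrite /letter; case: eqP => [e|_]; first by rewrite /nonneg e leqnn.
by case: ifP => // _; rewrite oppr_ge0.
Qed.

Lemma abs_letter i j : `|letter i|%N = `|letter j|%N <-> absI i = absI j.
Proof.
split=> [|e].
  rewrite !letter_absI; case: eqP => [ei|_]; case: eqP => [ej|_] //; last first.
    by case=> /val_inj.
  move=> _; congr absI; apply: val_inj.
  have := congr1 val ei; have := congr1 val ej; rewrite /=.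
  by have := ltn_ord i; have := ltn_ord j; lia.
by case: (absI_eq e) => ->; rewrite ?letter_rev ?abszN.
Qed.

Lemma letter_inj : injective letter.
Proof.
move=> i j e; have /abs_letter/absI_eq[//|ji] : `|letter i|%N = `|letter j|%N by rewrite e.
have /eqP : letter i = - letter i by rewrite -letter_rev -ji.
rewrite -addr_eq0 -mulr2n mulrn_eq0 /= letter_eq0 => /eqP ri.
by rewrite ji ri.
Qed.

End Letters.

Section Lists.
Variables (n : nat) (x0 : 'I_n) (A : {fset nat}).
Hypothesis AP : forall k : nat, (k \in A) <-> exists i : 'I_n, `|letter i|%N = k.
Implicit Types i j c : 'I_n.

Definition lists ss s : {fset seq int} := [fset t in map (map (@letter n)) (rcons ss s)]%fset.

Lemma mem_lists ss s t' :
  t' \in lists ss s -> exists2 t, t \in rcons ss s & t' = map (@letter n) t.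
Proof. by rewrite inE => /mapP. Qed.

Lemma last_letter t : t != [::] -> last 0 (map (@letter n) t) = letter (last x0 t).
Proof. by case: t => // a t _; rewrite /= last_map. Qed.

Section Valid.
Variables (ss : seq (seq 'I_n)) (s : seq 'I_n).
Hypothesis vs : valid x0 ss s.

Lemma valid_uniq : uniq (map (@absI n) (flatten (rcons ss s))).
Proof. by have [pw _ _ _ _] := vs; rewrite flatten_rcons (perm_uniq pw) uniq_halfpos. Qed.

Lemma valid_eq t u x y : t \in rcons ss s -> u \in rcons ss s -> x \in t -> y \in u ->
  absI x = absI y -> x = y /\ t = u.
Proof.
move=> tr ur xt yu e.
have xw : x \in flatten (rcons ss s) by apply/flattenP; exists t.
have yw : y \in flatten (rcons ss s) by apply/flattenP; exists u.
have xy := uniq_map_inj valid_uniq xw yw e; split=> //.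
by apply: (uniq_flatten_eq (map_uniq valid_uniq) tr ur xt); rewrite xy.
Qed.

Lemma valid_central t c : t \in rcons ss s -> c \in t -> central c -> t = s.
Proof.
move=> tr ct cc; have [_ _ _ _ [/hasP[d ds cd] _]] := vs.
have e : absI c = absI d by case: (central_eq cc cd) => ->; rewrite ?absI_rev.
by have [] := valid_eq tr (_ : s \in rcons ss s) ct ds e; rewrite // mem_rcons mem_head.
Qed.

Lemma valid_nonempty t : t \in rcons ss s -> t != [::] /\ nonneg (last x0 t).
Proof.
have [_ h nl _ [hc _]] := vs; rewrite mem_rcons inE => /orP[/eqP->|/h//].
by split=> //; case: (s) hc.
Qed.

Lemma valid_notin : s \notin ss.
Proof.
apply/negP => sss; have := map_uniq valid_uniq; rewrite flatten_rcons cat_uniq.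
move=> /and3P[_ /hasPn h _]; have [_ _ _ _ [/hasP[d ds _] _]] := vs.
by have := h d ds; rewrite /= (_ : d \in flatten ss) //; apply/flattenP; exists s.
Qed.

Lemma lists_SPIL : SPIL A (lists ss s).
Proof.
have sg t' : t' \in lists ss s -> signed_list A t'.
  move=> /mem_lists[t tr ->]; apply/andP; split.
    by apply/allP => _ /mapP[i _ ->]; apply/AP; exists i.
  have ut : uniq t.
    have := map_uniq valid_uniq; move: tr; elim: (rcons ss s) => //= a l IH.
    by rewrite inE cat_uniq => /orP[/eqP->|/IH h] /and3P[].
  rewrite /abs_list -map_comp map_inj_in_uniq // => x y xt yt /= /abs_letter e.
  by have [] := valid_eq tr tr xt yt e.
have [pw _ _ _ [hc hz]] := vs.
split=> //.
- split.
  + apply/seteqP; split=> [k [t' tl /= kt]|k /= kA].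
      have /andP[/allP h _] := sg t' tl.
      by move: kt => /mapP[z zt ->]; apply: h.
    have [i ik] := (AP k).1 kA.
    have : absI i \in map (@absI n) (flatten ss ++ s).
      by rewrite (perm_mem pw) mem_halfpos absI_nonneg.
    rewrite -flatten_rcons => /mapP[x /flattenP[t tr xt] e].
    exists (map (@letter n) t); first by rewrite /= inE map_f.
    rewrite /= /abs_list -map_comp; apply/mapP; exists x => //.
    by rewrite -ik /=; apply/abs_letter.
  + move=> t' u' /= /mem_lists[t tr ->] /mem_lists[u ur ->] [k /= []].
    rewrite /abs_list -!map_comp => /mapP[x xt ->] /mapP[y yu /= /abs_letter e].
    by have [_ ->] := valid_eq tr ur xt yu e.
  + move=> t' /= /mem_lists[t tr ->]; have [t0 _] := valid_nonempty tr.
    by case: t t0 {tr} => // a t _; exists `|letter a|%N; rewrite /= mem_head.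
- move=> t' /mem_lists[t tr ->]; have [t0 nt] := valid_nonempty tr.
  by rewrite last_letter // letter_ge0.
- move=> t' /mem_lists[t tr ->] /mapP[i it /esym/eqP]; rewrite letter_eq0 => /eqP ri.
  have ci : central i by rewrite /central ri andbb /lower ri -leqNgt ltnW.
  have ts := valid_central tr it ci; have [t0 _] := valid_nonempty tr.
  have is_ : i \in s by rewrite -ts.
  by rewrite last_letter // ts (hz i is_ ri); apply/eqP; rewrite letter_eq0 ri.
Qed.

End Valid.

(** [s] is recognized by its central letter, and the order of the other lists is forced by their
    strictly increasing last letters. *)
Lemma lists_inj ss s ss' s' : valid x0 ss s -> valid x0 ss' s' ->
  lists ss s = lists ss' s' -> (ss, s) = (ss', s').
Proof.
have half a b a' b' : valid x0 a b -> valid x0 a' b' -> lists a b = lists a' b' ->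
    [/\ {subset rcons a b <= rcons a' b'}, b = b' & {subset a <= a'}].
  move=> v v' e.
  have sub : {subset rcons a b <= rcons a' b'}.
    move=> t tr; have : map (@letter n) t \in lists a b by rewrite inE map_f.
    by rewrite e => /mem_lists[u ur /(inj_map (@letter_inj n)) ->].
  have bb : b = b'.
    have [_ _ _ _ [/hasP[c cb cc] _]] := v.
    by apply: (valid_central v' _ cb cc); apply: sub; rewrite mem_rcons mem_head.
  split=> // t ta; have : t \in rcons a' b' by apply: sub; rewrite mem_rcons inE ta orbT.
  rewrite mem_rcons inE => /orP[/eqP e'|//].
  by have := valid_notin v; rewrite bb -e' ta.
move=> v v' e; have [_ -> s1] := half _ _ _ _ v v' e.
have [_ _ s2] := half _ _ _ _ v' v (esym e).
congr (_, _); have [_ _ _ so _] := v; have [_ _ _ so' _] := v'.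
apply: (@irr_sorted_eq _ (relpre (last x0) (fun i j => i < j)%N)).
- by move=> a b c /=; apply: ltn_trans.
- by move=> a /=; rewrite ltnn.
- by rewrite -sorted_map.
- by rewrite -sorted_map.
- by move=> t; apply/idP/idP => [/s1|/s2].
Qed.

Definition pos (z : int) : 'I_n := odflt x0 [pick i | letter i == z].

Lemma posK z : `|z|%N \in A -> letter (pos z) = z.
Proof.
move=> /AP[i iz]; rewrite /pos; case: pickP => [j /eqP//|no].
have /orP[/eqP e|/eqP e] : (letter i == z) || (letter i == - z).
  by move: iz; lia.
- by have := no i; rewrite e eqxx.
- by have := no (rev_ord i); rewrite letter_rev e opprK eqxx.
Qed.

Lemma SPIL_valid S : SPIL A S -> exists ss s, valid x0 ss s /\ lists ss s = S.
Proof.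
move=> [sg [cov triv ne] nn zz].
have inA t z : t \in S -> z \in t -> `|z|%N \in A.
  by move=> tS zt; have /andP[/allP h _] := sg t tS; apply: h.
have mK t : t \in S -> map (@letter n) (map pos t) = t.
  move=> tS; rewrite -map_comp -[RHS]map_id; apply/eq_in_map => z zt /=.
  by rewrite posK // (inA t).
pose ls := [seq map pos t | t <- enum_fset S].
have lsP u : u \in ls -> map (@letter n) u \in S.
  by move=> /mapP[t tS ->]; rewrite mK.
have lsI t : t \in S -> map pos t \in ls by move=> tS; apply: map_f.
have uls : uniq ls.
  rewrite map_inj_in_uniq ?fset_uniq // => t u tS uS e.
  by rewrite -(mK t) // e mK.
have covI i : exists2 t, t \in ls & exists2 x, x \in t & absI x = absI i.
  have : [set` A]%classic `|letter i|%N by apply/AP; exists i.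
  rewrite -cov => -[t /= tS]; rewrite /abs_list => /mapP[z zt e].
  exists (map pos t); first exact: lsI.
  exists (pos z); first exact: map_f.
  by apply/abs_letter; rewrite e posK // (inA t).
have dis t u x y : t \in ls -> u \in ls -> x \in t -> y \in u -> absI x = absI y -> t = u.
  move=> tl ul xt yu /abs_letter e; apply: (inj_map (@letter_inj n)).
  apply: triv; [exact: lsP|exact: lsP|].
  exists `|letter x|%N; split=> /=; rewrite /abs_list -map_comp.
    exact: (map_f (absz \o @letter n)).
  by rewrite e; apply: (map_f (absz \o @letter n)).
have ut t : t \in ls -> uniq (map (@absI n) t).
  move=> tl; have /andP[_] := sg _ (lsP t tl); rewrite /abs_list -map_comp => u.
  have ut : uniq t := map_uniq u.
  by rewrite map_inj_in_uniq // => x y xt yt /abs_letter; apply: (uniq_map_inj u).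
have ne' t : t \in ls -> t != [::].
  by move=> tl; have [k /=] := ne _ (lsP t tl); case: (t).
have nn' t : t \in ls -> nonneg (last x0 t).
  by move=> tl; rewrite -letter_ge0 -last_letter ?ne' //; apply/nn/lsP.
have [c cc] := central_mid x0.
(* The list containing the central letter, up to sign, is set apart; the others are then sorted. *)
have [s sl [x xs xc]] := covI c.
pose r := relpre (fun t => last x0 t : nat) leq.
pose ss := sort r [seq t <- ls | t != s].
have mss t : (t \in ss) = (t != s) && (t \in ls) by rewrite mem_sort mem_filter.
have mr t : (t \in rcons ss s) = (t \in ls).
  by rewrite mem_rcons inE mss; case: eqP => [->|].
have uss : uniq ss by rewrite sort_uniq filter_uniq.
have ur : uniq (rcons ss s) by rewrite rcons_uniq uss mss eqxx.
have uw : uniq (map (@absI n) (flatten (rcons ss s))).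
  by apply: uniq_map_flatten => // [t|t u y z]; rewrite !mr; [exact: ut|exact: dis].
exists ss, s; split; last first.
  apply/fsetP => t; rewrite inE; apply/mapP/idP => [[u]|tS].
    by rewrite mr => ul ->; apply: lsP.
  by exists (map pos t); rewrite ?mr ?lsI ?mK.
split.
- rewrite -flatten_rcons; apply: uniq_perm => //; first exact: uniq_halfpos.
  move=> i; rewrite mem_halfpos; apply/mapP/idP => [[j _ ->]|ni]; first exact: absI_nonneg.
  have [t tl [y yt e]] := covI i; exists y; last by rewrite e absI_id.
  by apply/flattenP; exists t; rewrite ?mr.
- by move=> t; rewrite mss => /andP[_ tl]; rewrite ne' // nn'.
- exact: nn'.
- rewrite sorted_map; have : sorted ltn (map (fun t => last x0 t : nat) ss).
    rewrite ltn_sorted_uniq_leq sorted_map sort_sorted ?andbT; last first.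
      by move=> a b; apply: leq_total.
    rewrite map_inj_in_uniq // => t u; rewrite !mss => /andP[_ tl] /andP[_ ul] /val_inj e.
    have lt a : a \in ls -> last x0 a \in a.
      by move=> /ne'; case: (a) => // b l _; rewrite /= mem_last.
    by apply: (dis t u _ _ tl ul (lt t tl) (lt u ul)); rewrite e.
  by rewrite sorted_map.
- split; first by apply/hasP; exists x; rewrite // -central_absI xc central_absI.
  move=> i is_ ri; apply: (@letter_inj n); rewrite -last_letter ?ne' //.
  have l0 : letter i = 0 by apply/eqP; rewrite letter_eq0 ri.
  by rewrite l0; apply: zz; [exact: lsP | rewrite -l0 map_f].
Qed.

End Lists.

Local Open Scope classical_set_scope.
Local Open Scope card_scope.

(** The fibres of the two maps on admissible pairs agree: in both cases S is determined, and p is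
    determined up to the exchange of the central ranks. *)
Lemma orbits_SPIL (F : numClosedFieldType) n (x0 : 'I_n) (A : {fset nat}) (H : set 'M[F]_n) :
  (forall k : nat, (k \in A) <-> exists i : 'I_n, `|letter i|%N = k) ->
  (forall b, H b <-> stab_vref b) ->
  finite_set (orbits_flag_variety_so H) /\ orbits_flag_variety_so H #= SPIL A.
Proof.
move=> AP HP; rewrite (orbits_strata HP); split.
  exact/finite_image/finite_finset.
pose f (x : 'S_n * {set 'I_n}) :=
  let r := splitp (mem x.2) (word x.1 x.2) in lists r.1 r.2.
have -> : SPIL A = f @` @admissible_pairs n.
  apply/seteqP; split=> [S /(SPIL_valid x0 AP)[ss [s [v <-]]]|_ [x ax <-]]; last first.
    exact/(lists_SPIL AP)/(splitp_valid x0).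
  exists (rank v, marks x0 ss); first exact: admissible_rank.
  by rewrite /f /= splitp_rank.
apply: card_eq_image_kernel => x y ax ay; rewrite stratum_eq //; split.
  move: x y ax ay => [p S] [q S'] /= ax _ [<- [->//|->]].
  by rewrite /f /= word_swap.
move=> /(lists_inj (splitp_valid x0 ax) (splitp_valid x0 ay)).
rewrite -!surjective_pairing => /(splitp_word_inj x0 ax ay).
by case=> -> h.
Qed.

Theorem theorem3p9 (R : realType) :
  (forall l : nat, (1 <= l)%N ->
     finite_set (orbits_flag_variety_so (borel_SO_odd R[i] l)) /\
     orbits_flag_variety_so (borel_SO_odd R[i] l)
       #= SPIL [fset k in iota 1 l]%fset) /\
  (forall l : nat,
     finite_set (orbits_flag_variety_so (borel_SO_even R[i] l)) /\
     orbits_flag_variety_so (borel_SO_even R[i] l)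
       #= SPIL [fset k in iota 0 l.+1]%fset).
Proof.
split=> l => [l1|].
  have n0 : (0 < l.*2)%N by rewrite double_gt0.
  apply: (orbits_SPIL (Ordinal n0)) => [k|b]; last first.
    by rewrite -stab_vrefP vref_even.
  rewrite inE mem_iota; split=> [kl|[i <-]].
    (* Positions count from 0, so e_k has position k-1. *)
    have kn : (k.-1 < l.*2)%N by lia.
    exists (Ordinal kn); rewrite letter_absI ifN; last by rewrite -val_eqE /=; lia.
    by rewrite absI_id /nonneg /=; lia.
  rewrite letter_absI ifN; last by rewrite -val_eqE /=; have := ltn_ord i; lia.
  by have := absI_nonneg i; rewrite nonneg_half; lia.
apply: (orbits_SPIL ord0) => [k|b]; last by rewrite -stab_vrefP vref_odd.
rewrite !inE mem_iota; split=> [kl|[i <-]].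
  case: (posnP k) => [->|k0].
    have hl : (l < l.*2.+1)%N by lia.
    by exists (Ordinal hl); apply/eqP; rewrite absz_eq0 letter_eq0 -val_eqE /=; lia.
  have kn : (k.-1 < l.*2.+1)%N by lia.
  exists (Ordinal kn); rewrite letter_absI ifN; last by rewrite -val_eqE /=; lia.
  by rewrite absI_id /nonneg /=; lia.
rewrite letter_absI; case: (rev_ord i =P i) => // ne.
have := absI_nonneg i; rewrite nonneg_half => h.
have : absI i <> l :> nat.
  move=> e; apply: ne; apply: val_inj; have := ltn_ord i.
  by move: e; case: (absI_or i) => -> /=; lia.
by lia.
Qed.
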